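(* Let $M/L/K$ be a tower as described, with $[L:K]=n$, $[M:L]=m$, $\nu=v_p(n)$, $\mu=v_p(m)$. Let $0\le l\le\nu+\mu$ and $x\in[0,\infty)$. Then (a) $\phi_{M/K}^l(x)\ge\lambda_{M/K}^l(x)$; (b) if there exists $l_0\le l$ such that $|S_l^{l_0}(x)|=1$, then $\phi_{M/K}^l(x)=\lambda_{M/K}^l(x)$.
   Context: Let $p$ be a prime and $K$ a field complete with respect to a discrete valuation whose residue field is perfect of characteristic $p$; fix a separable closure $K^{sep}$; $v_p$ is the $p$-adic valuation on $\mathbb{Z}$. $L/K$ is a finite totally ramified subextension of $K^{sep}/K$ of degree $n>1$ and $M/L$ is a finite totally ramified subextension of $K^{sep}/L$ of degree $m>1$; so $M/K$ is totally ramified of degree $nm$ with $v_p(nm)=\nu+\mu$. For any such totally ramified extension $E/F$ of degree $N>1$ with $\eta=v_p(N)$, the indices of inseparability $i_0,\dots,i_\eta$ are defined by: choose uniformizers $\pi_F,\pi_E$, let $\hat{\mathcal{F}}(X)=\sum_{h\ge0}a_hX^{h+N}$ be the unique series with coefficients in the Teichmüller representatives of the residue field such that $\hat{\mathcal{F}}(\pi_E)=\pi_F$, put $\tilde{\imath}_j=\min\{h\ge0:v_p(h+N)\le j,\ a_h\ne0\}$ (or $\infty$), $i_\eta=0$ and $i_j=\min\{\tilde{\imath}_j,i_{j+1}+v_E(p)\}$ for $j=\eta-1,\dots,0$ ($v_E$ normalized with $v_E(E^\times)=\mathbb{Z}$, $v_E(p)=\infty$ in characteristic $p$); they are independent of choices.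 Set $\tilde{\phi}_{E/F}^j(x)=i_j+p^jx$ and $\phi_{E/F}^j(x)=\min\{\tilde{\phi}_{E/F}^{j_0}(x):0\le j_0\le j\}$ for $x\ge0$. Let $i_0,\dots,i_\nu$ be the indices of $L/K$. For $0\le j\le\nu$ define $\tilde{\phi}_{L/K}^{j,m}(x)=m\tilde{\phi}_{L/K}^j(x/m)=mi_j+p^jx$ and $\phi_{L/K}^{j,m}(x)=m\phi_{L/K}^j(x/m)$. For $0\le l\le\nu+\mu$ let $\Omega_l=\{(j,k):0\le j\le\nu,\ 0\le k\le\mu,\ j+k=l\}$ and define $\lambda_{M/K}^l(x)=\min\{\phi_{L/K}^{j,m}(\phi_{M/L}^k(x)):(j,k)\in\Omega_l\}$ (equivalently, the minimum of $\tilde{\phi}_{L/K}^{j,m}(\tilde{\phi}_{M/L}^k(x))$ over $(j,k)\in\Omega_{l_0}$, $0\le l_0\le l$). For $0\le a\le l$ set $S_l^a(x)=\{(j,k)\in\Omega_a:\tilde{\phi}_{L/K}^{j,m}(\tilde{\phi}_{M/L}^k(x))=\lambda_{M/K}^l(x)\}$. *)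

(* Defs.v *)
From HB Require Import structures.
From mathcomp Require Import all_boot all_order all_algebra all_field.
From mathcomp Require Import reals constructive_ereal.
Set Implicit Arguments. Unset Strict Implicit. Unset Printing Implicit Defensive.
Import Order.TTheory GRing.Theory Num.Theory.
Local Open Scope ring_scope.

(* Valuation data.  All fields live inside the top field M of the tower;
   [w : M -> int] is the normalized discrete valuation v_M of M
   (its value on 0 is irrelevant: "vge x B" means v_M(x) >= B, with
   v_M(0) = +oo).  Subfields of M containing K are {vspace M}'s of the
   fieldExtType M over K; K itself is 1%VS.                             *)

Definition vge {F : fieldType} (w : F -> int) (x : F) (B : int) : Prop :=
  x = 0 \/ B <= w x.

Definition is_norm_dvaluation {F : fieldType} (w : F -> int) : Prop :=
  [/\ forall x y, x != 0 -> y != 0 -> w (x * y) = w x + w y,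
      forall x y B, vge w x B -> vge w y B -> vge w (x + y) B &
      exists pi, pi != 0 /\ w pi = 1].

Definition complete_in {K : fieldType} {M : fieldExtType K}
  (w : M -> int) (F : {vspace M}) : Prop :=
  forall u : nat -> M, (forall k, u k \in F) ->
    (forall B, exists N, forall a b, (N <= a)%N -> (N <= b)%N ->
        vge w (u a - u b) B) ->
    exists lim, lim \in F /\
      (forall B, exists N, forall a, (N <= a)%N -> vge w (u a - lim) B).

Definition residue_perfect_char {K : fieldType} {M : fieldExtType K}
  (w : M -> int) (F : {vspace M}) (p : nat) : Prop :=
  vge w (p%:R) 1 /\
  forall x, x \in F -> vge w x 0 ->
    exists y, [/\ y \in F, vge w y 0 & vge w (y ^+ p - x) 1].

(* Teichmueller representatives (of the residue field) inside the
   complete field F: the elements of F that are p^e-th powers in F for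
   every e (Serre, Local Fields, II.4, Prop. 8); this set contains 0. *)
Definition teich {K : fieldType} {M : fieldExtType K}
  (p : nat) (F : {vspace M}) (t : M) : Prop :=
  t \in F /\ forall e : nat, exists s, s \in F /\ s ^+ (p ^ e) = t.

Definition is_min_opt (P : nat -> Prop) (o : option nat) : Prop :=
  match o with
  | Some h => P h /\ forall k, P k -> (h <= k)%N
  | None => forall k, ~ P k
  end.

Definition omin (a b : option nat) : option nat :=
  match a, b with
  | None, _ => b
  | _, None => a
  | Some x, Some y => Some (minn x y)
  end.

Definition oadd (a b : option nat) : option nat :=
  match a, b with
  | Some x, Some y => Some (x + y)%N
  | _, _ => None
  end.

(* v_E(p) for the subfield E with uniformizer of w-valuation eE, so that
   v_E = w / eE on E; +oo (None) if p = 0 in M (characteristic p). *)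
Definition vEp {K : fieldType} {M : fieldExtType K}
  (w : M -> int) (p eE : nat) : option nat :=
  if (p%:R : M) == 0 then None else Some (`|w p%:R|%N %/ eE)%N.

(* [is_indices w p F E eE N i]: i_0, ..., i_eta (eta = v_p(N)) are the
   indices of inseparability of the totally ramified extension E/F of
   degree N, where E has normalized valuation v_E = w / eE (i.e. a
   uniformizer of E has w-value eE) and v_F = w / (eE * N).
   (Values i j for j > eta are irrelevant and unconstrained.) *)
Definition is_indices {K : fieldType} {M : fieldExtType K}
  (w : M -> int) (p : nat) (F E : {vspace M}) (eE N : nat)
  (i : nat -> option nat) : Prop :=
  let eta := logn p N in
  exists (piF piE : M) (a : nat -> M) (it : nat -> option nat),
    [/\ piF \in F /\ w piF = (eE * N)%N,
        piE \in E /\ w piE = eE,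
        piF != 0 /\ piE != 0,
        (forall h, teich p F (a h)) &
     [/\
        (forall B, exists N0, forall N1, (N0 <= N1)%N ->
           vge w (piF - \sum_(h < N1) a h * piE ^+ (h + N)) B),
        (forall j, is_min_opt
           (fun h => (logn p (h + N) <= j)%N /\ a h != 0) (it j)),
        i eta = Some 0%N &
        (forall j, (j < eta)%N -> i j = omin (it j) (oadd (i j.+1) (vEp w p eE)))]].

Local Open Scope ereal_scope.

Definition oE {R : realType} (o : option nat) : \bar R :=
  match o with Some k => (k%:R)%:E | None => +oo end.

Definition tphi {R : realType} (p : nat) (i : nat -> option nat) (j : nat)
  (y : \bar R) : \bar R := oE (i j) + ((p ^ j)%:R)%:E * y.

Definition phi {R : realType} (p : nat) (i : nat -> option nat) (j : nat)
  (y : \bar R) : \bar R :=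
  \big[Order.min/+oo]_(j0 < j.+1) tphi p i j0 y.

Definition tphim {R : realType} (p : nat) (i : nat -> option nat) (m j : nat)
  (y : \bar R) : \bar R :=
  (m%:R)%:E * tphi p i j (y * ((m%:R)^-1)%:E).

Definition phim {R : realType} (p : nat) (i : nat -> option nat) (m j : nat)
  (y : \bar R) : \bar R :=
  (m%:R)%:E * phi p i j (y * ((m%:R)^-1)%:E).

Definition lambdaMK {R : realType} (p : nat) (iLK iML : nat -> option nat)
  (m nu mu l : nat) (x : R) : \bar R :=
  \big[Order.min/+oo]_(j < nu.+1)
    \big[Order.min/+oo]_(k < mu.+1 | (j + k == l)%N)
       phim p iLK m j (phi p iML k x%:E).

Definition S_set {R : realType} (p : nat) (iLK iML : nat -> option nat)
  (m nu mu l a : nat) (x : R) : {set 'I_nu.+1 * 'I_mu.+1} :=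
  [set jk : 'I_nu.+1 * 'I_mu.+1 |
     ((jk.1 : nat) + jk.2 == a)%N &&
     (tphim p iLK m jk.1 (tphi p iML jk.2 x%:E) == lambdaMK p iLK iML m nu mu l x)].

(* Main.v *)
(* For a power series P over O_K and a uniformizer pi put
   P(pi (1 + X)) = sum_s D_s X^s.  If P(pi) is a uniformizer of the base field F
   of a totally ramified extension E/F, or if P is the Eisenstein polynomial of
   pi, the numbers min_(1 <= t <= s) v(D_t) do not depend on P and pi, since P
   may be replaced by the Eisenstein polynomial of pi, and a change of pi is a
   change of the variable X.  On the other hand they are given by the indices of
   inseparability: v(D_s) >= v(pi^N) + i_j for j = v_p(s), with equality at
   s = p^j unless i_j = i_(j-1).

   In the tower take the Eisenstein polynomial f over K of the uniformizer
   G(pi_M) of L occurring in the data of M/L.  Writing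
   G(pi_M (1 + X)) = G(pi_M) (1 + eta), the D_s of f o G are the coefficients of
   sum_j D_j(f) eta^j, and the multinomial theorem bounds the coefficient of X^s
   below by the minimum of m i_c + p^c i_k (up to the constant nm) over
   p^(c + k) <= s.  This is (a).  If a single pair (c, k) attains the minimum at
   level l0 = c + k, the coefficient of X^(p^l0) has exactly this valuation,
   which is (b). *)
Require Import Defs.
From HB Require Import structures.
From mathcomp Require Import all_boot all_order all_algebra all_field.
From mathcomp Require Import boolp reals constructive_ereal.
From mathcomp Require Import zify ring.
Set Implicit Arguments. Unset Strict Implicit. Unset Printing Implicit Defensive.
Import Order.TTheory GRing.Theory Num.Theory.
Local Open Scope ring_scope.

(** The invariance of min_(1 <= t <= s) v(D_t) is not enough by itself: substituting eta requires a
    bound on each single D_s in terms of v_p(s). For an Eisenstein polynomial over K this bound can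
    be recovered, because the nonzero terms of D_s have pairwise distinct valuations and cannot
    cancel. Hence all coefficients are kept in K; this includes the series of M/L, since under total
    ramification the Teichmueller representatives of L already lie in K. Power series are replaced
    by polynomials truncated at a precision B. Thus G(pi_M) is only close to the uniformizer of L,
    and minima are handled through thresholds th, which also absorbs infinite indices. In (b)
    uniqueness is given at the level l0 only, while an exact valuation requires that no pair of
    lower level does as well. For x > 0 the summand p^l x excludes such pairs; for x = 0 one passes
    to the lowest level attaining the minimum. *)

(** * Discrete valuations *)

Section Valuation.
Variables (F : fieldType) (w : F -> int).
Hypothesis hw : is_norm_dvaluation w.
Implicit Types x y z : F.

Lemma wM x y : x != 0 -> y != 0 -> w (x * y) = w x + w y.
Proof. by case: hw => + _ _; apply. Qed.

Lemma w1 : w 1 = 0.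
Proof.
have : w (1 * 1) = w 1 + w 1 by apply: wM; exact: oner_neq0.
by rewrite mulr1; move: (w 1) => a; lia.
Qed.

Lemma wX x k : x != 0 -> w (x ^+ k) = k%:Z * w x.
Proof.
move=> x0; elim: k => [|k IHk]; first by rewrite expr0 w1 mul0r.
by rewrite exprS wM ?expf_neq0 // IHk; lia.
Qed.

Lemma wN x : w (- x) = w x.
Proof.
have [->|x0] := eqVneq x 0; first by rewrite oppr0.
have n1 : (-1 : F) != 0 by rewrite oppr_eq0 oner_neq0.
have e1 : w (-1) = 0.
  by have := wM n1 n1; rewrite mulrNN mulr1 w1; move: (w (-1)) => a; lia.
by rewrite -mulN1r wM // e1 add0r.
Qed.

Lemma wV x : x != 0 -> w x^-1 = - w x.
Proof.
move=> x0; have := wM x0 (invr_neq0 x0); rewrite divff // w1; lia.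
Qed.

Lemma vgeP x B : reflect (vge w x B) ((x == 0) || (B <= w x)).
Proof.
by apply: (iffP orP) => [[/eqP|]|[->|]]; [left|right|left|right].
Qed.

Lemma vge0 B : vge w 0 B.
Proof. by left. Qed.

Lemma vge_w x : vge w x (w x).
Proof. by right. Qed.

Lemma vge_le A B x : B <= A -> vge w x A -> vge w x B.
Proof. by move=> BA [->|xA]; [left|right; apply: le_trans xA]. Qed.

Lemma vgeNP x B : ~ vge w x B <-> x != 0 /\ w x < B.
Proof.
split=> [/vgeP|[x0 xB] /vgeP]; first by rewrite negb_or -ltNge => /andP.
by rewrite (negPf x0) /= leNgt xB.
Qed.

Lemma vge_neq0 x B : x != 0 -> vge w x B -> B <= w x.
Proof. by move=> x0 [xE|//]; rewrite xE eqxx in x0. Qed.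

Lemma vgeD x y B : vge w x B -> vge w y B -> vge w (x + y) B.
Proof. by case: hw => _ + _; apply. Qed.

Lemma vgeN x B : vge w x B -> vge w (- x) B.
Proof. by case=> [->|xB]; [rewrite oppr0; left|right; rewrite wN]. Qed.

Lemma vgeB x y B : vge w x B -> vge w y B -> vge w (x - y) B.
Proof. by move=> hx hy; apply: vgeD => //; apply: vgeN. Qed.

Lemma vgeBC x y B : vge w (x - y) B -> vge w (y - x) B.
Proof. by move=> /vgeN; rewrite opprB. Qed.

Lemma vgeM x y A B : vge w x A -> vge w y B -> vge w (x * y) (A + B).
Proof.
have [->|x0] := eqVneq x 0; first by rewrite mul0r; left.
have [->|y0] := eqVneq y 0; first by rewrite mulr0; left.
by move=> /(vge_neq0 x0) hx /(vge_neq0 y0) hy; right; rewrite wM ?lerD.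
Qed.

Lemma vgeMl x y B : vge w x 0 -> vge w y B -> vge w (x * y) B.
Proof. by rewrite -{2}[B]add0r; apply: vgeM. Qed.

Lemma vgeMr x y B : vge w x B -> vge w y 0 -> vge w (x * y) B.
Proof. by rewrite -{2}[B]addr0; apply: vgeM. Qed.

Lemma vge_sum (I : Type) (r : seq I) (P : pred I) (f : I -> F) B :
  (forall i, P i -> vge w (f i) B) -> vge w (\sum_(i <- r | P i) f i) B.
Proof.
move=> h; elim/big_ind: _ => // [|x y]; [exact: vge0|exact: vgeD].
Qed.

Lemma vge_natr k : vge w k%:R 0.
Proof.
elim: k => [|k IHk]; first exact: vge0.
by rewrite -natr1; apply: vgeD => //; right; rewrite w1.
Qed.

Lemma vgeX x k B : vge w x B -> vge w (x ^+ k) (k%:Z * B).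
Proof.
case=> [->|xB]; last first.
  have [->|x0] := eqVneq x 0; last by right; rewrite wX // ler_wpM2l.
  by case: k => [|k]; [right; rewrite expr0 w1 mul0r | rewrite expr0n; left].
by case: k => [|k]; [right; rewrite expr0 w1 mul0r | rewrite expr0n; left].
Qed.

Lemma vgeX0 x k : vge w x 0 -> vge w (x ^+ k) 0.
Proof. by move=> /(vgeX k); rewrite mulr0. Qed.

Lemma vge_prod (I : Type) (r : seq I) (P : pred I) (f : I -> F) :
  (forall i, P i -> vge w (f i) 0) -> vge w (\prod_(i <- r | P i) f i) 0.
Proof.
move=> h; elim/big_ind: _ => //; first by right; rewrite w1.
by move=> x y; apply: vgeMl.
Qed.

Lemma vge_dom x y : x != 0 -> vge w y (w x + 1) ->
  x + y != 0 /\ w (x + y) = w x.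
Proof.
move=> x0 hy.
have nx : ~ vge w (x + y) (w x + 1).
  move=> hxy; have : vge w (x + y - y) (w x + 1) by apply: vgeB.
  by rewrite addrK => /(vge_neq0 x0); lia.
move/vgeNP: nx => [xy0 hlt]; split=> //.
have : vge w (x + y) (w x).
  by apply: vgeD; [exact: vge_w|apply: vge_le hy; lia].
by move/(vge_neq0 xy0); lia.
Qed.

Lemma vge_eq0 x : (forall B, vge w x B) -> x = 0.
Proof.
move=> h; have [//|x0] := eqVneq x 0.
by have := vge_neq0 x0 (h (w x + 1)); lia.
Qed.

(** The nonzero term of least valuation strictly dominates all others, so it fixes the valuation of
    the sum. *)
Lemma vge_distinct_sum (I : finType) (f : I -> F) B :
  (forall i j, f i != 0 -> f j != 0 -> w (f i) = w (f j) -> i = j) ->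
  vge w (\sum_i f i) B -> forall i, vge w (f i) B.
Proof.
move=> inj hB i.
have [->|fi0] := eqVneq (f i) 0; first exact: vge0.
case: (@arg_minP _ _ I i (fun k => f k != 0) (fun k => w (f k)) fi0) => k fk0 hk.
suff h : w (\sum_i f i) = w (f k) /\ \sum_i f i != 0.
  case: h => h h0; right; apply: (le_trans _ (hk i fi0)); rewrite -h.
  exact: vge_neq0.
rewrite (bigD1 k) //=.
have := @vge_dom (f k) (\sum_(j | j != k) f j) fk0.
case; last by move=> -> ->.
apply: vge_sum => j jk; have [->|fj0] := eqVneq (f j) 0; first exact: vge0.
right; have := hk j fj0.
have : w (f j) != w (f k) by apply: contra_neq jk; apply: inj.
lia.
Qed.

End Valuation.

(* [tay pi P] is P(pi (1 + X)); its coefficients are the Hasse derivatives of P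
   at pi, scaled by powers of pi. *)
Definition tay (F : fieldType) (pi : F) (P : {poly F}) : {poly F} :=
  P \Po (pi *: (1 + 'X)).

(** * Expansions at x (1 + X) and their composition *)

Section Taylor.
Variables (F : fieldType).
Implicit Types (P Q : {poly F}) (x : F).

Lemma coef_1DXn k s : ((1 + 'X : {poly F}) ^+ k)`_s = ('C(k, s))%:R.
Proof.
rewrite addrC exprD1n coef_sum.
have [ks|sk] := ltnP k s.
  rewrite bin_small // big1 // => i _; rewrite coefMn coefXn.
  by rewrite (_ : (s == i) = false) ?mul0rn //; apply/negP => /eqP e; move: ks (ltn_ord i); rewrite e; lia.
have sk1 : (s < k.+1)%N by [].
rewrite (bigD1 (Ordinal sk1)) //= big1 ?addr0 => [|i ni].
  by rewrite coefMn coefXn eqxx.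
rewrite coefMn coefXn (_ : (s == i) = false) ?mul0rn //.
by apply/negP => /eqP e; case/negP: ni; apply/eqP/val_inj; rewrite /= e.
Qed.

Lemma tayM x P Q : tay x (P * Q) = tay x P * tay x Q.
Proof. exact: comp_polyM. Qed.

Lemma tayD x P Q : tay x (P + Q) = tay x P + tay x Q.
Proof. exact: comp_polyD. Qed.

Lemma tayB x P Q : tay x (P - Q) = tay x P - tay x Q.
Proof. exact: comp_polyB. Qed.

Lemma tayC x c : tay x c%:P = c%:P.
Proof. exact: comp_polyC. Qed.

Lemma coef_tay x P s :
  (tay x P)`_s = \sum_(h < size P) P`_h * x ^+ h * ('C(h, s))%:R.
Proof.
rewrite /tay comp_polyE coef_sum; apply: eq_bigr => h _.
by rewrite exprZn scalerA coefZ coef_1DXn.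
Qed.

Lemma coef0_tay x P : (tay x P)`_0 = P.[x].
Proof.
by rewrite coef_tay horner_coef; apply: eq_bigr => h _; rewrite bin0 mulr1.
Qed.

Lemma coef_tay_gt x P n s : (size P <= n)%N ->
  (tay x P)`_s = \sum_(h < n) P`_h * x ^+ h * ('C(h, s))%:R.
Proof.
move=> sn; rewrite coef_tay (big_ord_widen n (fun h => P`_h * x ^+ h * ('C(h, s))%:R)) //.
rewrite big_mkcond; apply: eq_bigr => h _; case: ltnP => // hs.
by rewrite nth_default ?mul0r.
Qed.

(** As y has no constant term, X^j divides y^j, and only the powers j <= s reach the coefficient of
    X^s. *)
Lemma coef_comp_X0 (A y : {poly F}) s : y`_0 = 0 ->
  (A \Po y)`_s = \sum_(j < s.+1) A`_j * (y ^+ j)`_s.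
Proof.
move=> y0; have vanish j : (s < j)%N -> (y ^+ j)`_s = 0.
  have -> : y = (\poly_(i < size y) y`_i.+1) * 'X.
    apply/polyP => -[|i]; rewrite coefMX //= coef_poly.
    by case: ltnP => // hi; rewrite nth_default // ltnW.
  by move=> sj; rewrite exprMn coefMXn sj.
rewrite comp_polyE coef_sum.
have -> : \sum_(i < size A) (A`_i *: y ^+ i)`_s =
  \sum_(i < maxn (size A) s.+1) A`_i * (y ^+ i)`_s.
  rewrite (big_ord_widen (maxn (size A) s.+1) (fun i => (A`_i *: y ^+ i)`_s)) ?leq_maxl //.
  rewrite big_mkcond; apply: eq_bigr => h _; case: ltnP => hs; rewrite ?coefZ //.
  by rewrite nth_default ?mul0r.
rewrite [RHS](big_ord_widen (maxn (size A) s.+1) (fun i => A`_i * (y ^+ i)`_s)) ?leq_maxr //.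
rewrite [RHS]big_mkcond; apply: eq_bigr => h _; case: ltnP => // hs.
by rewrite vanish ?mulr0.
Qed.

(* With G(x (1 + X)) = G(x) (1 + eta), P o G is expanded at x by substituting
   eta in the expansion of P at G(x). *)
Definition eta x P : {poly F} := (P.[x])^-1 *: (tay x P - (P.[x])%:P).

Lemma coef_eta x P k : (0 < k)%N -> (eta x P)`_k = (tay x P)`_k / P.[x].
Proof. by case: k => // k _; rewrite coefZ coefB coefC subr0 mulrC. Qed.

Lemma eta0 x P : (eta x P)`_0 = 0.
Proof. by rewrite coefZ coefB coef0_tay coefC eqxx subrr mulr0. Qed.

Lemma tay_comp x P Q : Q.[x] != 0 ->
  tay x (P \Po Q) = tay Q.[x] P \Po eta x Q.
Proof.
move=> Q0; rewrite {1 2}/tay -!comp_polyA; congr (_ \Po _).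
rewrite -/(tay x Q) comp_polyZ comp_polyD comp_polyX [1 \Po _]comp_polyC.
by rewrite /eta scalerDr scalerA divff // scale1r alg_polyC addrC subrK.
Qed.

End Taylor.

(** * Integral polynomials and minima of coefficient valuations *)

Section Integral.
Variables (F : fieldType) (w : F -> int).
Hypothesis hw : is_norm_dvaluation w.
Implicit Types (P Q : {poly F}) (x : F).

Definition ipoly P := forall i, vge w P`_i 0.

Lemma ipolyC c : vge w c 0 -> ipoly c%:P.
Proof. by move=> h i; rewrite coefC; case: ifP => // _; apply: vge0. Qed.

Lemma ipolyM P Q : ipoly P -> ipoly Q -> ipoly (P * Q).
Proof.
by move=> hP hQ i; rewrite coefM; apply: vge_sum => // j _; apply: vgeMl.
Qed.

Lemma ipolyX P k : ipoly P -> ipoly (P ^+ k).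
Proof.
move=> hP; elim: k => [|k IHk]; last by rewrite exprS; apply: ipolyM.
by rewrite expr0; apply: ipolyC; right; rewrite w1.
Qed.

Lemma vge_horner P x : ipoly P -> vge w x 0 -> vge w P.[x] 0.
Proof.
move=> hP hx; rewrite horner_coef; apply: vge_sum => // i _.
by apply: vgeMl => //; apply: vgeX0.
Qed.

Lemma ipoly_tay x P : vge w x 0 -> ipoly P -> ipoly (tay x P).
Proof.
move=> hx hP s; rewrite coef_tay; apply: vge_sum => // h _.
by apply: vgeMl => //; [apply: vgeMl => //; apply: vgeX0|apply: vge_natr].
Qed.

Lemma vge_subX x y k B : vge w x 0 -> vge w y 0 -> vge w (x - y) B ->
  vge w (x ^+ k - y ^+ k) B.
Proof.
move=> hx hy hB; rewrite subrXX; apply: vgeMr => //.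
by apply: vge_sum => // i _; apply: vgeMl => //; apply: vgeX0.
Qed.

Lemma tay_close x y P s B : vge w x 0 -> vge w y 0 -> ipoly P ->
  vge w (x - y) B -> vge w ((tay x P)`_s - (tay y P)`_s) B.
Proof.
move=> hx hy hP hB; rewrite !coef_tay -sumrB; apply: vge_sum => // h _.
rewrite -!mulrA -mulrBr; apply: vgeMl => //.
rewrite -mulrBl; apply: vgeMr => //; last exact: vge_natr.
exact: vge_subX.
Qed.

Lemma horner_close x y P B : vge w x 0 -> vge w y 0 -> ipoly P ->
  vge w (x - y) B -> vge w (P.[x] - P.[y]) B.
Proof. by move=> hx hy hP hB; rewrite -!coef0_tay; apply: tay_close. Qed.

(** Stands for th <= min_(1 <= t <= s) v(D_t); the threshold form lets a vanishing D_t count as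
    infinite. *)
Definition lev (D : nat -> F) (s : nat) (th : int) : Prop :=
  forall t, (0 < t <= s)%N -> vge w (D t) th.

Lemma lev_comp (A y : {poly F}) s th : ipoly y -> y`_0 = 0 ->
  lev (fun j => A`_j) s th -> lev (fun j => (A \Po y)`_j) s th.
Proof.
move=> hy y0 hA t /andP[t0 ts]; rewrite coef_comp_X0 //.
apply: vge_sum => // -[[|j] /= hj] _.
  by rewrite expr0 coef1 (gtn_eqF t0) mulr0; apply: vge0.
by apply: vgeMr => //; [apply: hA; lia|apply: ipolyX].
Qed.

Lemma ipoly_eta x P : vge w x 0 -> P.[x] != 0 ->
  (forall k, (0 < k)%N -> vge w (tay x P)`_k (w P.[x])) -> ipoly (eta x P).
Proof.
move=> hx P0 h [|k]; first by rewrite eta0; apply: vge0.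
rewrite coef_eta // -[X in vge _ _ X](addrN (w P.[x])).
apply: (vgeM hw); first exact: h.
by right; rewrite (wV hw).
Qed.

End Integral.

(** * Polynomials over O_K, expansions in powers of a uniformizer, Eisenstein polynomials *)

Section BaseField.
Variables (K : fieldType) (M : fieldExtType K).
Implicit Types (x y c : M) (P Q : {poly M}).

Lemma mem1M x y : x \in 1%VS -> y \in 1%VS -> x * y \in (1%VS : {vspace M}).
Proof.
move=> /vlineP[a ->] /vlineP[b ->].
by rewrite -scalerAl mul1r scalerA memvZ // mem1v.
Qed.

Lemma mem1X x k : x \in 1%VS -> x ^+ k \in (1%VS : {vspace M}).
Proof.
by move=> hx; elim: k => [|k IHk]; rewrite ?expr0 ?mem1v // exprS mem1M.
Qed.

Variable w : M -> int.
Hypothesis hw : is_norm_dvaluation w.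

(** Membership in O_K; [okpoly] is membership in O_K[X]. *)
Definition okc c := c \in (1%VS : {vspace M}) /\ vge w c 0.
Definition okpoly P := forall i, okc P`_i.

Lemma okc0 : okc 0.
Proof. by split; [exact: mem0v|exact: vge0]. Qed.

Lemma okc1 : okc 1.
Proof. by split; [exact: mem1v|right; rewrite (w1 hw)]. Qed.

Lemma okcD x y : okc x -> okc y -> okc (x + y).
Proof. by move=> [hx vx] [hy vy]; split; [exact: memvD|exact: vgeD]. Qed.

Lemma okcN x : okc x -> okc (- x).
Proof. by move=> [hx vx]; split; [rewrite memvN|exact: vgeN]. Qed.

Lemma okcM x y : okc x -> okc y -> okc (x * y).
Proof. by move=> [hx vx] [hy vy]; split; [exact: mem1M|exact: vgeMl]. Qed.

Lemma okc_sum (I : Type) (r : seq I) (A : pred I) (f : I -> M) :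
  (forall i, A i -> okc (f i)) -> okc (\sum_(i <- r | A i) f i).
Proof. move=> h; elim/big_ind: _ => // [|x y]; [exact: okc0|exact: okcD]. Qed.

Lemma okpolyD P Q : okpoly P -> okpoly Q -> okpoly (P + Q).
Proof. by move=> hP hQ i; rewrite coefD; apply: okcD. Qed.

Lemma okpolyN P : okpoly P -> okpoly (- P).
Proof. by move=> hP i; rewrite coefN; apply: okcN. Qed.

Lemma okpolyC c : okc c -> okpoly c%:P.
Proof. by move=> hc i; rewrite coefC; case: eqP => _ //; apply: okc0. Qed.

Lemma okpolyXn k : okpoly 'X^k.
Proof. by move=> i; rewrite coefXn; case: eqP => _; [apply: okc1|apply: okc0]. Qed.

Lemma okpolyM P Q : okpoly P -> okpoly Q -> okpoly (P * Q).
Proof. by move=> hP hQ i; rewrite coefM; apply: okc_sum => j _; apply: okcM. Qed.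

Lemma okpolyX P k : okpoly P -> okpoly (P ^+ k).
Proof.
move=> hP; elim: k => [|k IHk]; last by rewrite exprS; apply: okpolyM.
by rewrite expr0; apply: okpolyC; apply: okc1.
Qed.

Lemma okpoly_comp P Q : okpoly P -> okpoly Q -> okpoly (P \Po Q).
Proof.
move=> hP hQ i; rewrite comp_polyE coef_sum; apply: okc_sum => j _.
by rewrite coefZ; apply: okcM => //; apply: okpolyX.
Qed.

Lemma okpoly_poly k (f : nat -> M) :
  (forall i, (i < k)%N -> okc (f i)) -> okpoly (\poly_(i < k) f i).
Proof. by move=> h i; rewrite coef_poly; case: ltnP => // hi; [apply: h|apply: okc0]. Qed.

Lemma okpoly_ipoly P : okpoly P -> ipoly w P.
Proof. by move=> hP i; case: (hP i). Qed.

(** As f is monic, the division algorithm never divides by a coefficient, so quotient and remainder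
    stay in O_K[X]. *)
Lemma okpoly_div (f P : {poly M}) : okpoly f -> f \is monic -> okpoly P ->
  exists U r, [/\ okpoly U, okpoly r, (size r < size f)%N & P = f * U + r].
Proof.
move=> hf mf; have sf : (0 < size f)%N by rewrite size_poly_gt0 monic_neq0.
have [k] := ubnP (size P); elim: k P => // k IHk P sP hP.
have [lt|ge] := ltnP (size P) (size f).
  exists 0, P; split => //; last by rewrite mulr0 add0r.
  by move=> i; rewrite coef0; apply: okc0.
pose d := (size P - size f)%N; pose T := lead_coef P *: 'X^d : {poly M}.
have oT : okpoly T.
  by move=> i; rewrite coefZ; apply: okcM; [apply: hP|apply: okpolyXn].
have [||U [r [hU hr sr e]]] := IHk (P - f * T).
- have P0 : P != 0 by rewrite -size_poly_gt0 (leq_trans sf).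
  suff lt : (size (P - f * T)%R < size P)%N by apply: leq_trans lt _.
  have sT : (size (f * T)%R <= size P)%N.
    rewrite (leq_trans (size_polyMleq _ _)) //.
    have : (size T <= d.+1)%N.
      by rewrite (leq_trans (size_scale_leq _ _)) // size_polyXn.
    rewrite /d; lia.
  apply: (leq_trans (n := (size P).-1.+1)); last by rewrite prednK // (leq_trans sf).
  rewrite ltnS; apply/leq_sizeP => j hj; rewrite coefB.
  have [->|jP] := eqVneq j (size P).-1; last first.
    have lj : (size P <= j)%N by move: hj jP; lia.
    by rewrite !nth_default ?subrr // (leq_trans sT).
  rewrite /T -scalerAr coefZ coefMXn.
  have -> : ((size P).-1 < d)%N = false by rewrite /d; lia.
  have -> : ((size P).-1 - d)%N = (size f).-1 by rewrite /d; lia.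
  by move/monicP: mf; rewrite !lead_coefE => ->; rewrite mulr1 subrr.
- by apply: okpolyD => //; apply: okpolyN; apply: okpolyM.
exists (U + T), r; split=> //; first exact: okpolyD.
by rewrite mulrDr addrAC -e subrK.
Qed.

Section Uniformizer.
Variables n0 e0 : nat.
Hypothesis n0_gt1 : (1 < n0)%N.
Hypothesis e0_gt0 : (0 < e0)%N.
Hypothesis hK : forall y, y \in (1%VS : {vspace M}) -> y != 0 ->
  ((n0 * e0)%:Z %| w y)%Z.

(** On K the valuation takes only multiples of n0 e0, hence no value strictly between - n0 e0 and
    0. *)
Lemma vgeK c : c \in 1%VS -> vge w c (1 - (n0 * e0)%:Z) -> vge w c 0.
Proof.
move=> hc; case: (eqVneq c 0) => [->|c0 /(vge_neq0 c0) h]; first by left.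
right; case/dvdzP: (hK hc c0) => q; move: h => /[swap] ->.
have N0 : 0 < (n0 * e0)%:Z by lia.
rewrite pmulr_lge0 // => h; rewrite leNgt; apply/negP => q0.
have : q * (n0 * e0)%:Z <= (-1) * (n0 * e0)%:Z by rewrite ler_pM2r //; lia.
lia.
Qed.

Lemma vgeK1 c : c \in 1%VS -> vge w c 1 -> vge w c (n0 * e0)%:Z.
Proof.
move=> hc; case: (eqVneq c 0) => [->|c0 /(vge_neq0 c0) h]; first by left.
right; case/dvdzP: (hK hc c0) => q; move: h => /[swap] ->.
have N0 : 0 < (n0 * e0)%:Z by lia.
move=> h; rewrite ler_pMl // leNgt; apply/negP => q0.
have : q * (n0 * e0)%:Z <= 0 by rewrite pmulr_lle0 //; lia.
lia.
Qed.

Variable pi : M.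
Hypothesis wpi : w pi = e0.
Hypothesis pi0 : pi != 0.

(** The valuation of c_i pi^i is congruent to i e0 modulo n0 e0, which determines i < n0. *)
Lemma power_terms_distinct (c : nat -> M) (i j : nat) :
  (i < n0)%N -> (j < n0)%N ->
  c i \in 1%VS -> c j \in 1%VS -> c i * pi ^+ i != 0 -> c j * pi ^+ j != 0 ->
  w (c i * pi ^+ i) = w (c j * pi ^+ j) -> i = j.
Proof.
move=> iN jN ci cj; rewrite !mulf_eq0 !negb_or => /andP[ci0 pii] /andP[cj0 pij].
rewrite !(wM hw) // !(wX hw) // wpi.
case/dvdzP: (hK ci ci0) => q ->; case/dvdzP: (hK cj cj0) => q' ->.
have e0z : 0 < e0%:Z by lia.
rewrite !PoszM.
have -> : q * (n0%:Z * e0) + i%:Z * e0 = (q * n0 + i) * e0 by ring.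
have -> : q' * (n0%:Z * e0) + j%:Z * e0 = (q' * n0 + j) * e0 by ring.
move/mulIf => h; have {h} : q * n0 + i = q' * n0 + j :> int.
  by apply: h; rewrite gt_eqF.
have [->|] := eqVneq q q'; first by lia.
nia.
Qed.

Lemma vge_power_terms (c : nat -> M) B : (forall i, (i < n0)%N -> c i \in 1%VS) ->
  vge w (\sum_(i < n0) c i * pi ^+ i) B ->
  forall i, (i < n0)%N -> vge w (c i * pi ^+ i) B.
Proof.
move=> hc hB i hi.
apply: (vge_distinct_sum hw (f := fun i : 'I_n0 => c i * pi ^+ i) _ hB (Ordinal hi)).
move=> j k cj ck e; apply/val_inj.
exact: (power_terms_distinct (ltn_ord j) (ltn_ord k)
  (hc _ (ltn_ord j)) (hc _ (ltn_ord k)) cj ck e).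
Qed.

Variable E : {subfield M}.
Hypothesis hdim : \dim E = n0.
Hypothesis piE : pi \in E.

(** A vanishing combination of powers has valuation above any bound; by distinctness so has each of
    its terms. Hence the powers are free, and their number is the dimension of E. *)
Lemma power_basis y : y \in E -> exists c : nat -> M,
  (forall i, c i \in 1%VS) /\ y = \sum_(i < n0) c i * pi ^+ i.
Proof.
move=> yE; pose X := [tuple pi ^+ i | i < n0].
have XE i : X`_i = if (i < n0)%N then pi ^+ i else 0.
  case: ltnP => hi; last by rewrite nth_default // size_tuple.
  by rewrite -(tnth_nth 0 X (Ordinal hi)) tnth_mktuple.
have fX : free X.
  apply/freeP => k hk i.
  pose c j : M := if insub j is Some a then (k a)%:A else 0.
  have hc j : c j \in 1%VS.
    by rewrite /c; case: insubP => [u _ _|_]; rewrite ?mem0v // memvZ // mem1v.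
  have h0 j : (j < n0)%N ->
    vge w (c j * pi ^+ j) (i%:Z * e0%:Z + 1 + w (k i)%:A).
    move: j; apply: vge_power_terms => [j _|]; first exact: hc.
    rewrite (_ : \sum_(_ < _) _ = 0); first exact: vge0.
    rewrite -[RHS]hk; apply: eq_bigr => j _.
    by rewrite /c valK XE ltn_ord mulr_algl.
  have := h0 i (ltn_ord i); rewrite /c valK.
  have [k0 _|k0] := eqVneq (k i) 0; first exact: k0.
  have kA : (k i)%:A != 0 :> M by rewrite scaler_eq0 (negPf k0) oner_eq0.
  have pX : pi ^+ i != 0 by rewrite expf_neq0.
  move/(vge_neq0 (mulf_neq0 kA pX)).
  by rewrite (wM hw) // (wX hw) // wpi; lia.
have bX : basis_of E X.
  rewrite basisEfree fX size_tuple hdim leqnn andbT /=.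
  apply/span_subvP => v /(nthP 0)[i]; rewrite size_tuple card_ord => hi <-.
  by rewrite XE hi rpredX.
have := coord_basis bX yE; move=> ->.
exists (fun i => if insub i is Some a then (coord X a y)%:A else 0); split.
  by move=> i; case: insubP => [u _ _|_]; rewrite ?mem0v // memvZ // mem1v.
by apply: eq_bigr => i _; rewrite valK XE ltn_ord mulr_algl.
Qed.

Lemma integral_expansion y B : y \in E -> vge w y B ->
  exists c : nat -> M, [/\ forall i, c i \in 1%VS,
    y = \sum_(i < n0) c i * pi ^+ i &
    forall i, (i < n0)%N -> vge w (c i) (B - i%:Z * e0%:Z)].
Proof.
move=> yE yB; have [c [hc ey]] := power_basis yE.
exists c; split=> // i hi; rewrite ey in yB.
have h := vge_power_terms (fun i _ => hc i) yB hi.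
have [->|c0] := eqVneq (c i) 0; first exact: vge0.
have pX : pi ^+ i != 0 by rewrite expf_neq0.
move: h => /(vge_neq0 (mulf_neq0 c0 pX)); rewrite (wM hw) // (wX hw) // wpi.
by right; lia.
Qed.

(** The coefficients come from expanding pi^n0. If the constant one had valuation above n0 e0, so
    would every term, contradicting v(pi^n0) = n0 e0. *)
Lemma eisenstein : exists f : {poly M},
  [/\ okpoly f, f \is monic, size f = n0.+1, f.[pi] = 0 &
   [/\ w f`_0 = (n0 * e0)%:Z, f`_0 != 0 &
       forall i, (i < n0)%N -> vge w f`_i (n0 * e0)%:Z]].
Proof.
have pX : pi ^+ n0 != 0 by rewrite expf_neq0.
have [c [hc ec vc]] : exists c : nat -> M, [/\ forall i, c i \in 1%VS,
    pi ^+ n0 = \sum_(i < n0) c i * pi ^+ i &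
    forall i, (i < n0)%N -> vge w (c i) (n0%:Z * e0%:Z - i%:Z * e0%:Z)].
  apply: integral_expansion; first exact: rpredX.
  by right; rewrite (wX hw) // wpi.
have vcN i : (i < n0)%N -> vge w (c i) (n0 * e0)%:Z.
  move=> hi; apply: vgeK1 => //; apply: vge_le (vc i hi).
  by have := leq_mul hi (leqnn e0); rewrite mulSn; lia.
pose f := 'X^n0 - \poly_(i < n0) c i.
have fi i : (i < n0)%N -> f`_i = - c i.
  by move=> hi; rewrite coefB coefXn coef_poly hi (ltn_eqF hi) sub0r.
have sf : (size (\poly_(i < n0) c i) < size ('X^n0 : {poly M}))%N.
  by rewrite size_polyXn ltnS size_poly.
have sfE : size f = n0.+1 by rewrite /f size_polyDl ?size_polyN // size_polyXn.
exists f; split=> //.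
- apply: okpolyD; first exact: okpolyXn.
  apply: okpolyN; apply: okpoly_poly => i hi; split=> //.
  by apply: vge_le (vcN i hi).
- by rewrite monicE lead_coefDl ?size_polyN // lead_coefXn.
- by rewrite hornerD hornerN hornerXn horner_poly ec subrr.
have n00 : (0 < n0)%N by lia.
suff : ~ vge w (c 0%N) ((n0 * e0)%:Z + 1).
  move/vgeNP => [c0 hlt]; have /(vge_neq0 c0) := vcN _ n00.
  rewrite fi // oppr_eq0 (wN hw); split=> //; first by lia.
  by move=> i hi; rewrite fi //; apply: vgeN => //; apply: vcN.
move=> h0; have : vge w (pi ^+ n0) ((n0 * e0)%:Z + 1).
  rewrite ec; apply: vge_sum => // -[[|i] hi] _ /=; first by rewrite expr0 mulr1.
  apply: (vge_le (A := (n0 * e0)%:Z + i.+1%:Z * e0%:Z)); first by lia.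
  apply: (vgeM hw); first exact: vcN.
  by right; rewrite (wX hw) // wpi.
by move/(vge_neq0 pX); rewrite (wX hw) // wpi; lia.
Qed.

End Uniformizer.

End BaseField.

(** * Independence of the polynomial and of the uniformizer *)

Section Comparison.
Variables (K : fieldType) (M : fieldExtType K) (w : M -> int).
Hypothesis hw : is_norm_dvaluation w.
Variables (E : {subfield M}) (n0 e0 : nat).
Hypothesis hdim : \dim E = n0.
Hypothesis n0_gt1 : (1 < n0)%N.
Hypothesis e0_gt0 : (0 < e0)%N.
Hypothesis hK : forall y, y \in (1%VS : {vspace M}) -> y != 0 ->
  ((n0 * e0)%:Z %| w y)%Z.
Implicit Types (f P Q U r : {poly M}) (pi : M).

Lemma vge_tay_lt pi r B : pi \in E -> w pi = e0 -> pi != 0 ->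
  okpoly w r -> (size r <= n0)%N -> vge w r.[pi] B ->
  (forall i, vge w (r`_i * pi ^+ i) B) /\ forall t, vge w (tay pi r)`_t B.
Proof.
move=> piE wpi pi0 hr sr hB.
have h i : vge w (r`_i * pi ^+ i) B.
  have [hi|hi] := ltnP i n0; last first.
    by rewrite nth_default ?mul0r; [exact: vge0|exact: leq_trans hi].
  apply: (vge_power_terms hw n0_gt1 e0_gt0 hK wpi pi0 (c := fun i => r`_i)) => // [j _|].
    by case: (hr j).
  by rewrite -(horner_coef_wide _ sr).
split=> // t; rewrite (coef_tay_gt _ _ (leqnn _)); apply: vge_sum => // j _.
by apply: vgeMr => //; apply: vge_natr.
Qed.

(** Since f(pi) = 0, the t-th coefficient of the product involves only the coefficients of f of
    index 1 to t. *)
Lemma lev_of_factor f U r Q pi s th : f.[pi] = 0 -> ipoly w U -> vge w pi 0 ->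
  (forall t, vge w (tay pi r)`_t th) -> Q = f * U + r ->
  lev w (fun t => (tay pi f)`_t) s th -> lev w (fun t => (tay pi Q)`_t) s th.
Proof.
move=> f0 hU hpi hr -> hf t /andP[t0 ts]; rewrite tayD tayM coefD coefM.
apply: vgeD => //; apply: vge_sum => // -[[|j] hj] _ /=.
  by rewrite coef0_tay f0 mul0r; apply: vge0.
by apply: vgeMr => //; [apply: hf; lia|apply: ipoly_tay].
Qed.

(** Converse of [lev_of_factor]: U(pi) is a unit, so the coefficients of f can be solved for one
    after the other. *)
Lemma lev_factor f U r Q pi s th : f.[pi] = 0 -> ipoly w U -> vge w pi 0 ->
  w U.[pi] = 0 -> U.[pi] != 0 ->
  (forall t, vge w (tay pi r)`_t th) -> Q = f * U + r ->
  lev w (fun t => (tay pi Q)`_t) s th -> lev w (fun t => (tay pi f)`_t) s th.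
Proof.
move=> f0 hU hpi wU U0 hr eQ hQ t.
have [k] := ubnP t; elim: k t => // k IHk t tk /andP[t0 ts].
have := hQ t; rewrite t0 ts => /(_ isT); rewrite eQ tayD tayM coefD coefM.
move/(vgeB hw) => /(_ _ (hr t)); rewrite addrK big_ord_recr /= subnn coef0_tay.
have hs : vge w (\sum_(i < t) (tay pi f)`_i * (tay pi U)`_(t - i)) th.
  apply: vge_sum => // -[[|j] hj] _ /=.
    by rewrite coef0_tay f0 mul0r; apply: vge0.
  by apply: vgeMr => //; [apply: IHk; lia|apply: ipoly_tay].
move/(vgeB hw) => /(_ _ hs); rewrite addrAC subrr add0r => h.
rewrite -[_`_t](mulfK U0); apply: vgeMr => //.
by right; rewrite (wV hw) // wU.
Qed.

(* Both sides are compared with the Eisenstein polynomial f of pi2 over K: if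
   pi1 = g(pi2) then P1(g(X)) - c1 is f times a power series which is a unit,
   up to an error of valuation at least B. *)
Lemma lev_transfer P1 P2 pi1 pi2 c1 c2 s th B :
  okpoly w P1 -> okpoly w P2 ->
  pi1 \in E -> w pi1 = e0 -> pi1 != 0 -> pi2 \in E -> w pi2 = e0 -> pi2 != 0 ->
  c1 \in 1%VS -> c2 \in 1%VS -> th <= B -> (n0 * e0)%:Z < B ->
  vge w (P1.[pi1] - c1) B -> vge w (P2.[pi2] - c2) B ->
  P1`_0 - c1 != 0 -> w (P1`_0 - c1) = (n0 * e0)%:Z -> vge w P1`_1 1 ->
  lev w (fun t => (tay pi1 P1)`_t) s th -> lev w (fun t => (tay pi2 P2)`_t) s th.
Proof.
move=> hP1 hP2 pi1E wpi1 pi10 pi2E wpi2 pi20 c1K c2K thB NB hB1 hB2 d0 wd hP11 lev1.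
have v1 : vge w pi1 0 by right; rewrite wpi1.
have v2 : vge w pi2 0 by right; rewrite wpi2.
have B0 : 0 <= B by clear -NB; lia.
have okint P pi c : okpoly w P -> vge w pi 0 -> c \in 1%VS ->
    vge w (P.[pi] - c) B -> okc w c.
  move=> hP hpi cK hB; split=> //; rewrite -[c](subKr P.[pi]).
  apply: vgeB => //; last exact: vge_le hB.
  by apply: vge_horner => //; apply: okpoly_ipoly.
have oc1 := okint _ _ _ hP1 v1 c1K hB1.
have oc2 := okint _ _ _ hP2 v2 c2K hB2.
have [f [hf mf sf f0 [wf0 f00 hfi]]] :=
  eisenstein hw n0_gt1 e0_gt0 hK wpi2 pi20 hdim pi2E.
have [c [cK epi1 vc]] : exists c : nat -> M, [/\ forall i, c i \in 1%VS,
    pi1 = \sum_(i < n0) c i * pi2 ^+ i &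
    forall i, (i < n0)%N -> vge w (c i) (e0%:Z - i%:Z * e0%:Z)].
  apply: (integral_expansion hw n0_gt1 e0_gt0 hK wpi2 pi20 hdim pi2E pi1E).
  by right; rewrite wpi1.
pose g := \poly_(i < n0) c i.
have hg : okpoly w g.
  apply: okpoly_poly => // i hi; split=> //; apply: (vgeK n0_gt1 e0_gt0 hK) => //.
  have := leq_mul hi (leqnn e0); rewrite mulSn => le.
  by apply: vge_le (vc i hi); clear -le e0_gt0; lia.
have gpi : g.[pi2] = pi1 by rewrite horner_poly -epi1.
have vg0 : vge w g`_0 (n0 * e0)%:Z.
  rewrite coef_poly (ltnW n0_gt1); apply: (vgeK1 n0_gt1 e0_gt0 hK) => //.
  by apply: vge_le (vc 0%N (ltnW n0_gt1)); clear -e0_gt0; lia.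
pose Q := P1 \Po g - c1%:P.
have hQ : okpoly w Q.
  by apply: okpolyD => //; [exact: okpoly_comp|apply/okpolyN/okpolyC].
have [U [r [hU hr sr eQ]]] := okpoly_div hw hf mf hQ.
rewrite sf ltnS in sr.
have Qpi : Q.[pi2] = P1.[pi1] - c1 by rewrite hornerD hornerN hornerC horner_comp gpi.
have [rB tB] : (forall i, vge w (r`_i * pi2 ^+ i) B) /\ forall t, vge w (tay pi2 r)`_t B.
  by apply: vge_tay_lt => //; move: hB1; rewrite -Qpi eQ hornerD hornerM f0 mul0r add0r.
have lQ : lev w (fun t => (tay pi2 Q)`_t) s th.
  move=> t ht; rewrite tayB tayC coefB coefC.
  have t0 : (t == 0)%N = false by case/andP: ht => /gtn_eqF.
  rewrite t0 subr0 tay_comp ?gpi //; move: t ht {t0}; apply: lev_comp => //.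
    apply: ipoly_eta => //; rewrite ?gpi // => k k0; rewrite wpi1.
    (* Coefficients of positive degree do not see g_0, and all other terms g_j pi2^j have valuation
       at least e0 = w pi1. *)
    have -> : (tay pi2 g)`_k = (tay pi2 (g - (g`_0)%:P))`_k.
      by rewrite tayB tayC coefB coefC (gtn_eqF k0) subr0.
    rewrite (coef_tay_gt _ _ (leqnn _)); apply: vge_sum => // j _.
    apply: vgeMr => //; last exact: vge_natr.
    rewrite coefB coefC; case: j => -[|j] hj /=.
      by rewrite subrr mul0r; apply: vge0.
    rewrite subr0; have := hg j.+1 => -[_ hgj].
    have -> : e0%:Z = 0 + e0%:Z by rewrite add0r.
    apply: (vgeM hw) => //; right; rewrite (wX hw) // wpi2.
    by have := leq_pmull e0 (ltn0Sn j); clear; lia.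
  by rewrite eta0.
(* Compare constant terms in Q = f U + r. The valuation of Q_0 = P1(g_0) - c1 is that of P1_0 - c1:
   v(g_0) >= n0 e0, P1_1 is not a unit, and the higher terms contain g_0^2. It equals w(f_0), and
   r_0 is smaller than this precision allows, so U_0 is a unit. *)
have wU0 : U`_0 != 0 /\ w U`_0 = 0.
  have e : Q`_0 = f`_0 * U`_0 + r`_0 by rewrite eQ coefD coef0M.
  have e' : f`_0 * U`_0 = (P1`_0 - c1) + (\sum_(i < size P1) P1`_i.+1 * g`_0 ^+ i.+1 - r`_0).
    apply: (addIr r`_0); rewrite -e addrA subrK coefB coefC /=.
    rewrite -[(P1 \Po g)`_0]horner_coef0 horner_comp horner_coef0.
    rewrite [P1.[g`_0]](horner_coef_wide _ (leqnSn _)).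
    by rewrite big_ord_recl /= expr0 mulr1 addrAC.
  have [nz wE] : f`_0 * U`_0 != 0 /\ w (f`_0 * U`_0) = (n0 * e0)%:Z.
    rewrite e' -wd; apply: vge_dom => //; rewrite wd; apply: vgeB => //; last first.
      by have := rB 0%N; rewrite expr0 mulr1; apply: vge_le; clear -NB; lia.
    apply: vge_sum => // -[[|i] hi] _ /=.
      by rewrite expr1 addrC; apply: (vgeM hw).
    apply: vgeMl => //; first by case: (hP1 i.+2).
    apply: vge_le (vgeX hw i.+2 vg0).
    have := leq_mul (isT : (2 <= i.+2)%N) (leqnn (n0 * e0)).
    have : (0 < n0 * e0)%N by rewrite muln_gt0 (ltnW n0_gt1).
    by move: (n0 * e0)%N => N; clear; lia.
  move: nz; rewrite mulf_eq0 negb_or => /andP[_ U0]; split=> //.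
  by move: wE; rewrite (wM hw) // wf0; clear; lia.
have wU : U.[pi2] != 0 /\ w U.[pi2] = 0.
  case: wU0 => U0 wU0; rewrite (horner_coef_wide _ (leqnSn _)) big_ord_recl /= expr0 mulr1.
  rewrite -[in RHS]wU0; apply: vge_dom => //; rewrite wU0 add0r; apply: vge_sum => // i _.
  apply: vgeMl => //; first by case: (hU i.+1).
  by right; rewrite (wX hw) // wpi2 -PoszM lez_nat muln_gt0 e0_gt0.
have lf : lev w (fun t => (tay pi2 f)`_t) s th.
  case: wU => U0 wU; apply: (lev_factor f0 (okpoly_ipoly hU) v2 wU U0 _ eQ lQ).
  by move=> t; apply: vge_le (tB t).
have hQ2 : okpoly w (P2 - c2%:P) by apply: okpolyD => //; apply/okpolyN/okpolyC.
have [U2 [r2 [hU2 hr2 sr2 eQ2]]] := okpoly_div hw hf mf hQ2.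
rewrite sf ltnS in sr2.
have [_ tB2] : (forall i, vge w (r2`_i * pi2 ^+ i) B) /\ forall t, vge w (tay pi2 r2)`_t B.
  apply: vge_tay_lt => //; move: hB2.
  by rewrite -[c2](hornerC c2 pi2) -hornerN -hornerD eQ2 hornerD hornerM f0 mul0r add0r.
have l2 : lev w (fun t => (tay pi2 (P2 - c2%:P))`_t) s th.
  apply: (lev_of_factor f0 (okpoly_ipoly hU2) v2 _ eQ2 lf).
  by move=> t; apply: vge_le (tB2 t).
move=> t ht; have := l2 t ht; rewrite tayB tayC coefB coefC.
by case: eqP ht => [->|_ _]; rewrite ?subr0.
Qed.

End Comparison.

(** * Teichmueller representatives *)

Section Teichmuller.
Variables (K : fieldType) (M : fieldExtType K) (w : M -> int) (p : nat).
Hypothesis hw : is_norm_dvaluation w.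
Hypothesis p_pr : prime p.
Hypothesis hp : vge w p%:R 1.
Implicit Types a b t : M.

(** The cofactor of a - b in a^p - b^p is congruent to p a^(p-1), hence has positive valuation. *)
Lemma vge_subXp a b k : vge w a 0 -> vge w b 0 -> (0 < k)%N ->
  vge w (a - b) k%:Z -> vge w (a ^+ p - b ^+ p) k.+1%:Z.
Proof.
move=> ha hb k0 hab; rewrite subrXX -addn1 PoszD; apply: (vgeM hw) => //.
have -> : \sum_(i < p) a ^+ (p.-1 - i) * b ^+ i =
  \sum_(i < p) (a ^+ (p.-1 - i) * b ^+ i - a ^+ p.-1) + p%:R * a ^+ p.-1.
  by rewrite sumrB sumr_const card_ord mulr_natl subrK.
apply: vgeD => //; last by apply: vgeMr => //; apply: vgeX0.
apply: vge_sum => // i _.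
rewrite -{2}(subnK (n := p.-1) (m := i)); last by have := ltn_ord i; lia.
rewrite exprD -mulrBr; apply: vgeMl => //; first exact: vgeX0.
apply: vge_subX => //; apply: vgeBC => //; apply: vge_le hab.
by rewrite lez_nat.
Qed.

Lemma vge_subXpn a b e : vge w a 0 -> vge w b 0 ->
  vge w (a - b) 1 -> vge w (a ^+ (p ^ e) - b ^+ (p ^ e)) e.+1%:Z.
Proof.
move=> ha hb hab; elim: e => [|e IHe]; first by rewrite !expr1.
by rewrite expnSr !exprM; apply: vge_subXp => //; apply: vgeX0.
Qed.

Variable N : nat.
Hypothesis hcomp : complete_in w 1%VS.
Hypothesis hdim : \dim {:M} = N.
Hypothesis N_gt1 : (1 < N)%N.
Hypothesis hK : forall y, y \in (1%VS : {vspace M}) -> y != 0 ->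
  (N%:Z %| w y)%Z.

(** By total ramification M and K have the same residue field; c is the constant term of the
    expansion of t in powers of a uniformizer. *)
Lemma residue_in_base t : vge w t 0 ->
  exists c, okc w c /\ vge w (t - c) 1.
Proof.
move=> ht; case: (hw) => _ _ [pi [pi0 wpi]].
have hK1 y : y \in (1%VS : {vspace M}) -> y != 0 -> ((N * 1)%:Z %| w y)%Z.
  by rewrite muln1; apply: hK.
have [c [cK et vc]] := integral_expansion hw N_gt1 (ltn0Sn 0) hK1 wpi pi0
  (E := fullv) hdim (memvf pi) (memvf t) ht.
have vc0 i : (i < N)%N -> vge w (c i) 0.
  move=> hi; apply: (vgeK N_gt1 (ltn0Sn 0) hK1) => //.
  by apply: vge_le (vc i hi); lia.
exists (c 0%N); split; first by split=> //; apply: vc0; lia.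
rewrite et -(prednK (ltnW N_gt1)) big_ord_recl expr0 mulr1 addrC addKr.
apply: vge_sum => // i _; apply: vgeMl => //.
  by apply: vc0; rewrite lift0; have := ltn_ord i; lia.
by right; rewrite (wX hw) // wpi lift0; lia.
Qed.

(** For e = |w t|, p^e divides w t but exceeds its absolute value. *)
Lemma teich_unit (E : {vspace M}) t : teich p E t -> t != 0 -> w t = 0.
Proof.
move=> [_ ht] t0; have [s [_ es]] := ht `|w t|%N.
have p1 := prime_gt1 p_pr.
have s0 : s != 0.
  by move: t0; rewrite -es expf_eq0 negb_and expn_gt0 (ltnW p1).
have := wX hw (p ^ `|w t|) s0; rewrite es.
have := ltn_expl `|w t|%N p1.
have [->|s1 lt e] := eqVneq (w s) 0; first by rewrite mulr0.
have : (p ^ `|w t| <= `|w t|)%N.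
  by rewrite {2}e abszM absz_nat leq_pmulr // absz_gt0.
by rewrite leqNgt lt.
Qed.

(** If t = s^(p^e) and s is congruent to c in O_K, then c^(p^e) approximates t up to valuation e +
    1. Completeness of K puts the limit t in K. *)
Lemma teich_okc (E : {vspace M}) t : teich p E t -> okc w t.
Proof.
move=> ht; have [->|t0] := eqVneq t 0; first exact: okc0.
have wt := teich_unit ht t0; have vt : vge w t 0 by right; rewrite wt.
split=> //; case: ht => _ ht.
have : forall e, exists u, u \in 1%VS /\ vge w (t - u) e.+1%:Z.
  move=> e; have [s [_ es]] := ht e.
  have p1 := prime_gt1 p_pr.
  have s0 : s != 0 by move: t0; rewrite -es expf_eq0 negb_and expn_gt0 (ltnW p1).
  have vs : vge w s 0.
    right; move: wt; rewrite -es (wX hw) // => /eqP; rewrite mulf_eq0 => /orP[|/eqP ->//].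
    by rewrite eqz_nat expn_eq0; case: (p) p1.
  have [c [[cK vc] hc]] := residue_in_base vs.
  exists (c ^+ (p ^ e)); split; first exact: mem1X.
  by rewrite -es; apply: vge_subXpn.
case/boolp.choice => u hu.
have [|l [lK hl]] := hcomp (fun k => proj1 (hu k)).
  move=> B; exists `|B|%N => a b ha hb.
  have -> : u a - u b = (t - u b) - (t - u a) by ring.
  by apply: vgeB => //; [apply: vge_le (proj2 (hu b))|apply: vge_le (proj2 (hu a))]; lia.
suff -> : t = l by [].
apply/eqP; rewrite -subr_eq0; apply/eqP; apply: (vge_eq0 (w := w)) => B.
have [N0 hN0] := hl B; pose a := maxn N0 `|B|%N.
have -> : t - l = (t - u a) + (u a - l) by ring.
apply: vgeD => //; last by apply: hN0; apply: leq_maxl.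
by apply: vge_le (proj2 (hu a)); rewrite /a; lia.
Qed.

End Teichmuller.

(** * Valuations at p of binomial coefficients *)

Section Binomials.
Local Open Scope nat_scope.
Variable p : nat.
Hypothesis p_pr : prime p.

(** From s C(n, s) = n C(n-1, s-1). *)
Lemma dvdn_bin_logn n s : (0 < s)%N ->
  p ^ (logn p n - logn p s) %| 'C(n, s).
Proof.
case: s => // s _; have [->|n0] := posnP n; first by rewrite bin0n dvdn0.
have [ns|sn] := ltnP n s.+1; first by rewrite bin_small ?dvdn0.
have e := mul_bin_diag n s.
have c0 : (0 < 'C(n, s.+1))%N by rewrite bin_gt0.
have c1 : (0 < 'C(n.-1, s))%N by rewrite bin_gt0; lia.
have := congr1 (logn p) e; rewrite !lognM // => el.
by rewrite pfactor_dvdn //; lia.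
Qed.

(** As p^j divides n, n - i and i have the same valuation for 0 < i < p^j. Consequently C(n-1, p^j -
    1) is prime to p. *)
Lemma logn_fact_sub n j s : (0 < n)%N -> (j <= logn p n)%N -> (s < p ^ j)%N ->
  logn p (n.-1 ^_ s) = logn p s`!.
Proof.
move=> n0 jn; elim: s => [|s IHs] lt; first by rewrite ffactn0.
have pjn : p ^ j %| n by rewrite pfactor_dvdn.
have lepn : (p ^ j <= n)%N by apply: dvdn_leq.
rewrite ffactnSr factS lognM ?ffact_gt0 //; try lia.
rewrite lognM ?fact_gt0 // IHs; last by lia.
rewrite addnC; congr (_ + _)%N.
have -> : (n.-1 - s = n - s.+1)%N by lia.
have Sv : (logn p s.+1 < j)%N.
  rewrite ltnNge -pfactor_dvdn //; apply/negP => /dvdn_leq => /(_ isT); lia.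
have nv : (j <= logn p n)%N by [].
apply/eqP; rewrite eqn_leq; apply/andP; split; last first.
  rewrite -pfactor_dvdn ?subn_gt0; try lia.
  rewrite dvdn_sub // ?pfactor_dvdn //; lia.
rewrite leqNgt; apply/negP => hlt.
suff : p ^ (logn p s.+1).+1 %| s.+1 by rewrite pfactor_dvdn // ltnn.
have e : s.+1 = n - (n - s.+1) by lia.
by rewrite {2}e dvdn_sub // pfactor_dvdn //; lia.
Qed.

Lemma logn_bin_pow n j : (0 < n)%N -> (j <= logn p n)%N ->
  logn p 'C(n, p ^ j) = (logn p n - j)%N.
Proof.
move=> n0 jn; have pj0 : (0 < p ^ j)%N by rewrite expn_gt0 prime_gt0.
have lepn : (p ^ j <= n)%N by apply: dvdn_leq => //; rewrite pfactor_dvdn.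
have e := mul_bin_diag n (p ^ j).-1; rewrite prednK // in e.
have := congr1 (logn p) e; rewrite !lognM ?bin_gt0 //; last by lia.
rewrite pfactorK //.
have -> : logn p 'C(n.-1, (p ^ j).-1) = 0%N; last by lia.
have := bin_ffact n.-1 (p ^ j).-1 => /(congr1 (logn p)).
rewrite lognM ?fact_gt0 // ?bin_gt0; last by lia.
by rewrite (logn_fact_sub n0 jn) ?ltn_predL //; lia.
Qed.

Lemma logn_leq_of_expn s j t : (0 < s)%N -> (s <= t)%N -> (t <= p ^ j)%N ->
  (logn p s <= j)%N.
Proof.
move=> s0 st tj; rewrite -(leq_exp2l _ _ (prime_gt1 p_pr)).
by rewrite (leq_trans _ (leq_trans st tj)) // dvdn_leq // pfactor_dvdnn.
Qed.

End Binomials.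

(** * Valuations of integers *)

Section ValuationNat.
Variables (F : fieldType) (w : F -> int) (p : nat).
Hypothesis hw : is_norm_dvaluation w.
Hypothesis p_pr : prime p.
Hypothesis hp : vge w p%:R 1.

(** By Bezout, positive valuations of both p and q would give 1 a positive valuation. *)
Lemma coprime_natr_unit q : coprime p q -> q%:R != 0 :> F /\ w q%:R = 0.
Proof.
move=> cpq; have nq : ~ vge w q%:R 1.
  move=> hq; have q_gt0 : (0 < q)%N.
    case: q cpq {hq} => // /eqP; rewrite gcdn0 => p1.
    by move: p_pr; rewrite p1.
  case: (egcdnP p q_gt0) => a b e _.
  move: cpq; rewrite coprime_sym => /eqP g1; rewrite g1 in e.
  have : vge w (a * q)%:R 1 by rewrite natrM; apply: vgeMl => //; apply: vge_natr.
  rewrite e natrD natrM => h.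
  have : vge w (b%:R * p%:R) 1 by apply: vgeMl => //; apply: vge_natr.
  move/(vgeB hw h); rewrite addrAC subrr add0r => /(vge_neq0 (oner_neq0 F)).
  by rewrite (w1 hw).
move/vgeNP: nq => [q0 lt]; split=> //.
by have := vge_neq0 q0 (vge_natr hw q); move: lt; clear; lia.
Qed.

(** The condition on the power of p treats both characteristics at once: if p = 0 it says that p
    does not divide n. *)
Lemma natr_neq0 n : (0 < n)%N -> p%:R ^+ logn p n != 0 :> F -> n%:R != 0 :> F.
Proof.
move=> n_gt0 pn; have [q cpq eq_n] := pfactor_coprime p_pr n_gt0.
by rewrite eq_n natrM natrX mulf_neq0 //; case: (coprime_natr_unit cpq).
Qed.

Lemma natr_logn_neq0 n : n%:R != 0 :> F -> p%:R ^+ logn p n != 0 :> F.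
Proof.
move=> n0; have n_gt0 : (0 < n)%N by case: n n0 => //; rewrite eqxx.
have [q cpq eq_n] := pfactor_coprime p_pr n_gt0.
by move: n0; rewrite {1}eq_n natrM natrX mulf_eq0 negb_or => /andP[].
Qed.

Lemma w_natr n : n%:R != 0 :> F -> w n%:R = (logn p n)%:Z * w p%:R.
Proof.
move=> n0; have n_gt0 : (0 < n)%N by case: n n0 => //; rewrite eqxx.
have pn := natr_logn_neq0 n0.
have [q cpq eq_n] := pfactor_coprime p_pr n_gt0.
have [q0 wq] := coprime_natr_unit cpq.
rewrite {1}eq_n natrM natrX (wM hw) // wq add0r.
case: (posnP (logn p n)) pn => [-> _|l0]; first by rewrite expr0 mul0r (w1 hw).
by rewrite expf_eq0 l0 /= => p0; rewrite (wX hw).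
Qed.

Lemma vge_dvdn n k z B : (p ^ k %| n)%N -> vge w (p%:R ^+ k * z) B ->
  vge w (n%:R * z) B.
Proof.
case/dvdnP => q -> h; rewrite natrM natrX -mulrA; apply: vgeMl => //.
exact: vge_natr.
Qed.

End ValuationNat.

(** * Multinomial expansion of a power of a polynomial *)

Section Multinomial.
Variable R : comNzRingType.

(* In the multinomial expansion of y^j the coefficient N of prod_k c_k^(m_k) is
   such that j divides N m_k for all k.  The term c_kappa^j is split off when
   kappa < D; an index kappa >= D singles out nothing. *)
Lemma multinomial_coef (T : R -> Prop) (D : nat) (c : nat -> R) (kappa j s : nat) :
  T 0 -> (forall x y, T x -> T y -> T (x + y)) ->
  (forall (m : nat -> nat) (N : nat),
     (\sum_(k < D) m k = j)%N -> (\sum_(k < D) k * m k = s)%N ->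
     (forall k, (k < D)%N -> (j %| N * m k)%N) ->
     ((kappa < D)%N -> m kappa <> j) ->
     T (N%:R * \prod_(k < D) c k ^+ m k)) ->
  T (((\poly_(k < D) c k) ^+ j)`_s -
     (if (kappa < D)%N && (kappa * j == s)%N then c kappa ^+ j else 0)).
Proof.
elim: D T kappa j s => [|D IHD] T kappa j s T0 TD hT.
  rewrite poly_def big_ord0 subr0; case: j hT => [|j] hT; last first.
    by rewrite exprS mul0r coef0.
  rewrite expr0 coef1; case: s hT => [|s] hT //=.
  by have := hT (fun=> 0%N) 1%N; rewrite !big_ord0 mulr1; apply.
have -> : \poly_(k < D.+1) c k = \poly_(k < D) c k + c D *: 'X^D.
  by rewrite !poly_def big_ord_recr.
set y := \poly_(k < D) c k.
have term i : (((y ^+ (j - i) * (c D *: 'X^D) ^+ i) *+ 'C(j, i))`_s =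
    if (s < D * i)%N then 0 else ((y ^+ (j - i))`_(s - D * i) * c D ^+ i) *+ 'C(j, i))%R.
  rewrite coefMn exprZn -exprM -scalerAr coefZ coefMXn.
  by case: ltnP => _; rewrite ?mulr0 ?mul0rn // mulrC.
(* Extends an exponent vector by m_D = i. The divisibility survives because i C(j, i) = j C(j-1,
   i-1) and (j - i) C(j, i) = j C(j-1, i). *)
have ext i (m : nat -> nat) (N : nat) : (i <= j)%N -> (D * i <= s)%N ->
    (\sum_(k < D) m k = j - i)%N -> (\sum_(k < D) k * m k = s - D * i)%N ->
    (forall k, (k < D)%N -> (j - i %| N * m k)%N) ->
    ((kappa < D)%N -> m kappa <> j) -> (kappa = D -> i <> j) ->
    T ((N%:R * \prod_(k < D) c k ^+ m k * c D ^+ i) *+ 'C(j, i)).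
  move=> ij Ds e1 e2 dv mk iD.
  pose m' k := if k == D then i else m k.
  have m'E (k : 'I_D) : m' k = m k by rewrite /m' (ltn_eqF (ltn_ord k)).
  have m'D : m' D = i by rewrite /m' eqxx.
  have -> : (N%:R * \prod_(k < D) c k ^+ m k * c D ^+ i) *+ 'C(j, i) =
    ('C(j, i) * N)%:R * \prod_(k < D.+1) c k ^+ m' k.
    rewrite big_ord_recr /= m'D natrM -mulr_natl -!mulrA.
    by do 2!congr (_ * _); congr (_ * _); apply: eq_bigr => k _; rewrite m'E.
  apply: hT.
  - rewrite big_ord_recr /= m'D (eq_bigr (fun k : 'I_D => m k)) ?e1 ?subnK //.
  - rewrite big_ord_recr /= m'D (eq_bigr (fun k : 'I_D => (k * m k)%N)) ?e2 ?subnK //.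
    by move=> k _; rewrite m'E.
  - move=> k; rewrite ltnS leq_eqVlt => /orP[/eqP ->|kD].
      rewrite m'D; case: i {term ij Ds e1 e2 dv m' m'E m'D mk iD} => [|i]; first by rewrite muln0.
      by rewrite mulnAC [('C(_, _) * _)%N]mulnC -mul_bin_diag -mulnA dvdn_mulr.
    rewrite /m' (ltn_eqF kD) -mulnA; have /dvdnP[q ->] := dv k kD.
    rewrite mulnCA [('C(_, _) * _)%N]mulnC -mul_bin_down.
    by rewrite mulnCA dvdn_mulr.
  - rewrite ltnS leq_eqVlt => /orP[/eqP e|kD]; first by rewrite e m'D; apply: iD.
    by rewrite /m' (ltn_eqF kD); apply: mk.
have Tsum (I : Type) (r : seq I) (P : pred I) (f : I -> R) :
    (forall i, P i -> T (f i)) -> T (\sum_(i <- r | P i) f i).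
  by move=> h; elim/big_ind: _ => // a b; apply: (TD).
rewrite exprDn coef_sum.
(* For kappa = D the power split off is the summand i = j of the binomial theorem. *)
have [kD|kD] := eqVneq kappa D.
  rewrite kD ltnSn /= big_ord_recr /= -addrA; apply: (TD); last first.
    rewrite term subnn expr0 coef1 binn mulr1n; case: ltngtP => // h.
    - by rewrite subr0.
    - by rewrite (gtn_eqF _) ?subn_gt0 // mul0r subr0.
    - by rewrite -h subnn mul1r subrr.
  apply: Tsum => -[i ij] _ /=; rewrite term; case: ltnP => // Di.
  (* The induction quantifies over T so that T can absorb the factor C(j, i) c_D^i; the value D for
     [kappa] singles out nothing here. *)
  have := IHD (fun x => T ((x * c D ^+ i) *+ 'C(j, i))) D (j - i)%N (s - D * i)%N.
  rewrite ltnn subr0; apply.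
  - by rewrite mul0r mul0rn.
  - by move=> a b Ta Tb; rewrite mulrDl mulrnDl; apply: (TD).
  - move=> m N e1 e2 dv _; apply: (ext) => //; first exact: ltnW.
    + by rewrite kD ltnn.
    + by move=> _; lia.
have -> : (kappa < D.+1)%N = (kappa < D)%N by rewrite ltnS leq_eqVlt (negPf kD).
rewrite big_ord_recl /= addrAC; apply: (TD); last first.
  apply: Tsum => -[i ij] _; rewrite /bump /= add1n term; case: ltnP => // Di.
  have := IHD (fun x => T ((x * c D ^+ i.+1) *+ 'C(j, i.+1))) D (j - i.+1)%N (s - D * i.+1)%N.
  rewrite ltnn subr0; apply.
  - by rewrite mul0r mul0rn.
  - by move=> a b Ta Tb; rewrite mulrDl mulrnDl; apply: (TD).
  - move=> m N e1 e2 dv _; apply: (ext) => // [kD' mk|e]; last by rewrite e eqxx in kD.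
    by move: e1; rewrite (bigD1 (Ordinal kD')) //= mk; lia.
rewrite term muln0 ltn0 expr0 mulr1 bin0 mulr1n !subn0.
apply: IHD => // m N e1 e2 dv mk.
have := ext 0%N m N; rewrite muln0 !subn0 expr0 mulr1 bin0 mulr1n.
by apply=> // e; rewrite e eqxx in kD.
Qed.

End Multinomial.

(** * Index sequences with infinite values *)

Section Indices.
Variables (F : fieldType) (w : F -> int) (p : nat).
Hypothesis hw : is_norm_dvaluation w.
Hypothesis p_pr : prime p.
Hypothesis hp : vge w p%:R 1.
Implicit Types (z : F) (I : nat -> option nat).

(** [None] is the bound +oo, which only 0 satisfies. *)
Definition vgeo z (o : option nat) : Prop :=
  if o is Some k then vge w z k%:Z else z = 0.

Lemma vgeo0 o : vgeo 0 o.
Proof. by case: o => [k|//]; apply: vge0. Qed.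

Lemma vgeoD z z' o : vgeo z o -> vgeo z' o -> vgeo (z + z') o.
Proof. by case: o => [k|-> ->]; [apply: vgeD|rewrite addr0]. Qed.

Lemma vgeo_sum (J : Type) (r : seq J) (P : pred J) (f : J -> F) o :
  (forall i, P i -> vgeo (f i) o) -> vgeo (\sum_(i <- r | P i) f i) o.
Proof. by move=> h; elim/big_ind: _ => // [|x y]; [apply: vgeo0|apply: vgeoD]. Qed.

Lemma vgeoMl c z o : vge w c 0 -> vgeo z o -> vgeo (c * z) o.
Proof. by case: o => [k|_ ->]; [apply: vgeMl|rewrite mulr0]. Qed.

Lemma vgeo_vge z o th : (forall k, o = Some k -> th <= k%:Z) -> vgeo z o ->
  vge w z th.
Proof.
case: o => [k h|_ ->]; last exact: vge0.
by apply: vge_le; apply: h.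
Qed.

Lemma vgeoP z o : vgeo z o <->
  forall th, (forall k, o = Some k -> th <= k%:Z) -> vge w z th.
Proof.
split=> [h th hth|]; first exact: vgeo_vge h.
case: o => [k|] h; first by apply: h => j [<-].
by apply: (vge_eq0 (w := w)) => B; apply: h.
Qed.

Lemma vgeo_neq0 z o : z != 0 -> vgeo z o -> exists2 k, o = Some k & k%:Z <= w z.
Proof.
move=> z0; case: o => [k|/= zE]; last by rewrite zE eqxx in z0.
by move=> /(vge_neq0 z0); exists k.
Qed.

(** The inequalities I_j <= I_(j+1) + v(p) and I_j <= I_i for i <= j, phrased through elements z so
    that infinite I and p = 0 are included. *)
Definition index_chain I nu : Prop :=
  (forall j z, (j < nu)%N -> vgeo z (I j.+1) -> vgeo (p%:R * z) (I j)) /\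
  (forall i j z, (i <= j <= nu)%N -> vgeo z (I i) -> vgeo z (I j)).

(* D s stands for a scaled s-th Hasse derivative: it has valuation at least
   I_j for j = v_p(s), and I_j is attained at s = p^j unless I_j = I_(j-1). *)
Definition has_indices (D : nat -> F) I nu : Prop :=
  (forall s, (0 < s)%N -> vgeo (D s) (I (minn (logn p s) nu))) /\
  (forall j k, (j <= nu)%N -> I j = Some k ->
     exists j', [/\ (j' <= j)%N, I j' = Some k, D (p ^ j')%N != 0 &
                    w (D (p ^ j')%N) = k%:Z]).

Lemma index_chain_expn I nu i j z : index_chain I nu -> (i <= j <= nu)%N ->
  vgeo z (I j) -> vgeo (p%:R ^+ (j - i) * z) (I i).
Proof.
move=> [hs _] /andP[]; elim: j z => [|j IHj] z.
  by rewrite leqn0 => /eqP -> _; rewrite expr0 mul1r.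
rewrite leq_eqVlt => /orP[/eqP -> _|lt jn hz]; first by rewrite subnn expr0 mul1r.
rewrite subSn // exprSr -mulrA; apply: IHj => //; first exact: ltnW.
exact: hs.
Qed.

(** Here I_j becomes the minimum of v(D_t) over 1 <= t <= p^j: such t have v_p(t) <= j, I is
    nonincreasing, and the value is attained at some p^j' with j' <= j. *)
Lemma lev_indices D I nu j th : index_chain I nu -> has_indices D I nu ->
  (j <= nu)%N ->
  lev w D (p ^ j) th <-> (forall k, I j = Some k -> th <= k%:Z).
Proof.
move=> [_ mono] [lo ex] jnu; split=> [hl k Ik|hth t /andP[t0 tj]].
  have [j' [j'j _ D0 <-]] := ex j k jnu Ik.
  apply: vge_neq0 => //; apply: hl.
  by rewrite expn_gt0 prime_gt0 //= leq_exp2l // prime_gt1.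
have lt : (logn p t <= j)%N by apply: (logn_leq_of_expn p_pr t0 (leqnn t) tj).
apply: (vgeo_vge hth); apply: mono (lo t t0); rewrite jnu andbT.
by rewrite geq_min lt.
Qed.

End Indices.

(** * Indices read off a series with Teichmueller coefficients *)

Section TeichmullerSeries.
Variables (F : fieldType) (w : F -> int) (p : nat).
Hypothesis hw : is_norm_dvaluation w.
Hypothesis p_pr : prime p.
Hypothesis hp : vge w p%:R 1.
Variables (e N : nat) (pi : F) (a : nat -> F) (it i : nat -> option nat).
Hypothesis e_gt0 : (0 < e)%N.
Hypothesis N_gt0 : (0 < N)%N.
Hypothesis pi0 : pi != 0.
Hypothesis wpi : w pi = e%:Z.
Hypothesis ha : forall h, a h != 0 -> w (a h) = 0.
Hypothesis a00 : a 0%N != 0.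
Hypothesis wp_dvd : p%:R != 0 :> F -> ((e * N)%:Z %| w p%:R)%Z.
Let eta := logn p N.
Let v : option nat := if p%:R == 0 :> F then None else Some (`|w p%:R|%N %/ e)%N.
Hypothesis hit : forall j, is_min_opt
  (fun h => (logn p (h + N) <= j)%N /\ a h != 0) (it j).
Hypothesis i_eta : i eta = Some 0%N.
Hypothesis i_rec : forall j, (j < eta)%N -> i j = omin (it j) (oadd (i j.+1) v).

Let ve := (`|w p%:R|%N %/ e)%N.
(** Indices in the normalization of w: the valuation of pi^(N + i_j). *)
Let I j := omap (fun k => e * (N + k))%N (i j).

Let wp_ve : p%:R != 0 :> F -> w p%:R = (e * ve)%:Z /\ (N %| ve)%N /\ (0 < ve)%N.
Proof.
move=> p0; have wp1 : 1 <= w p%:R by apply: vge_neq0.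
have /dvdzP[q eq] := wp_dvd p0.
have q0 : 0 < q.
  move: wp1; rewrite eq => h.
  have : 0 < q * (e * N)%:Z by apply: lt_le_trans h.
  by rewrite pmulr_lgt0 // ltz_nat muln_gt0 e_gt0.
have : ve = (`|q| * N)%N.
  by rewrite /ve eq abszM /= mulnCA mulKn.
move=> ->; split; last by rewrite dvdn_mull // muln_gt0 N_gt0 absz_gt0 gt_eqF.
by rewrite eq !PoszM gtz0_abs //; ring.
Qed.

Let w_term u h : p%:R ^+ u != 0 :> F ->
  w (p%:R ^+ u * pi ^+ (h + N)) = (e * (N + (h + u * ve)))%:Z.
Proof.
move=> pu; have pX : pi ^+ (h + N) != 0 by rewrite expf_neq0.
rewrite (wM hw pu pX) (wX hw _ pi0) wpi.
case: (posnP u) pu => [-> _|u0]; first by rewrite expr0 (w1 hw); lia.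
rewrite expf_eq0 u0 /= => p0; rewrite (wX hw) //.
by have [-> _] := wp_ve p0; rewrite !PoszM !PoszD !PoszM; ring.
Qed.

(** Unfolding the recursion, every level below v_p(h + N) costs v_E(p), so i_j <= h + max(0, v_p(h +
    N) - j) v_E(p). Truncated subtraction provides the max. *)
Let index_le j h : (j <= eta)%N -> a h != 0 ->
  vgeo w (p%:R ^+ (logn p (h + N) - j) * pi ^+ (h + N)) (I j).
Proof.
move=> jeta ah; have [d] := ubnP (eta - j); elim: d j jeta => // d IHd j jeta jd.
have [->|jn] := eqVneq j eta.
  rewrite /I i_eta /=; apply: vgeMl => //; first by apply: vgeX0 => //; apply: vge_le hp.
  by right; rewrite (wX hw) // wpi; lia.
have lt : (j < eta)%N by lia.
have [vj|vj] := leqP (logn p (h + N)) j.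
  have := hit j; case Eit : (it j) => [t|]; last by move=> /= /(_ h (conj vj ah)).
  move=> [_ /(_ h (conj vj ah)) th].
  have [k Ek kt] : exists2 k, i j = Some k & (k <= t)%N.
    rewrite i_rec // Eit; case: (oadd _ _) => [b|] /=; last by exists t.
    by exists (minn t b) => //; apply: geq_minl.
  rewrite /I Ek /= (eqP vj) expr0 mul1r; right; rewrite (wX hw) // wpi.
  by rewrite -PoszM lez_nat mulnC leq_mul2r; lia.
have h1 := IHd j.+1 lt ltac:(lia).
have -> : (logn p (h + N) - j = (logn p (h + N) - j.+1).+1)%N by lia.
rewrite exprS -mulrA; move: h1; set z := _ * _ => hz.
have [p0|p0] := eqVneq (p%:R : F) 0; first by rewrite p0 mul0r; apply: vgeo0.
rewrite /I i_rec // /v (negPf p0).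
move: hz; rewrite /I; case: (i j.+1) => [k1 /= hz|/= ->]; last by rewrite mulr0; apply: vgeo0.
have hpz : vge w (p%:R * z) (e * (N + (k1 + ve)))%:Z.
  have [wpE _] := wp_ve p0; have -> : (e * (N + (k1 + ve)))%:Z = w p%:R + (e * (N + k1))%:Z.
    by rewrite wpE; lia.
  by apply: (vgeM hw) => //; apply: vge_w.
case: (it j) => [t|] //=; apply: vge_le hpz.
by rewrite lez_nat leq_mul2l leq_add2l geq_minr orbT.
Qed.

(** Following the branch chosen by each minimum of the recursion ends at one h whose cost in
    [index_le] is exactly i_j. The nonvanishing power of p excludes steps of infinite cost. *)
Let index_attained j k : (j <= eta)%N -> i j = Some k ->
  exists h, [/\ a h != 0, (logn p (h + N) <= eta)%N,
    p%:R ^+ (logn p (h + N) - j) != 0 :> F & k = (h + (logn p (h + N) - j) * ve)%N].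
Proof.
move=> jeta; have [d] := ubnP (eta - j); elim: d j jeta k => // d IHd j jeta k jd.
have [->|jn] := eqVneq j eta.
  by rewrite i_eta => -[<-]; exists 0%N; rewrite add0n subnn expr0 oner_eq0.
have lt : (j < eta)%N by lia.
have direct t : it j = Some t -> exists h, [/\ a h != 0, (logn p (h + N) <= eta)%N,
    p%:R ^+ (logn p (h + N) - j) != 0 :> F & t = (h + (logn p (h + N) - j) * ve)%N].
  move=> Et; have := hit j; rewrite Et => -[[vt at0] _]; exists t.
  by rewrite (eqP vt) expr0 oner_eq0 mul0n addn0 (leq_trans vt).
rewrite i_rec // /v; have [p0|p0] := eqVneq (p%:R : F) 0.
  have -> : oadd (i j.+1) None = None by case: (i j.+1).
  by case Et : (it j) => [t|] //= [<-]; apply: direct.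
case E1 : (i j.+1) => [k1|]; last by case Et : (it j) => [t|] //= [<-]; apply: direct.
have [|h [ah vh pv ek1]] := IHd j.+1 lt k1 _ E1; first by lia.
have [vj|vj] := leqP (logn p (h + N)) j.
  have := hit j; case Et : (it j) => [t|]; last by move=> /= /(_ h (conj vj ah)).
  move=> [_ /(_ h (conj vj ah)) th] [<-].
  by rewrite (_ : minn _ _ = t); [apply: direct|apply/minn_idPl; move: ek1; rewrite /ve; lia].
case Et : (it j) => [t|] /= [ek].
  have [tk|tk] := leqP t (k1 + ve).
    by rewrite -ek (minn_idPl tk); apply: direct.
  exists h; split=> //; first by rewrite expf_neq0.
  rewrite -ek (minn_idPr (ltnW tk)) ek1.
  have -> : (logn p (h + N) - j = (logn p (h + N) - j.+1).+1)%N by lia.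
  by rewrite mulSn addnAC addnA.
exists h; split=> //; first by rewrite expf_neq0.
rewrite -ek ek1.
have -> : (logn p (h + N) - j = (logn p (h + N) - j.+1).+1)%N by lia.
by rewrite mulSn addnAC addnA.
Qed.

Lemma teich_index_mono j j' k : (j <= j' <= eta)%N -> i j = Some k ->
  exists2 k', i j' = Some k' & (k' <= k)%N.
Proof.
move=> /andP[jj' j'eta] Ek.
have [h [ah vh pv ->]] := index_attained (leq_trans jj' j'eta) Ek.
have pv' : p%:R ^+ (logn p (h + N) - j') != 0 :> F.
  case: (posnP (logn p (h + N) - j')) => [->|pos]; first by rewrite expr0 oner_eq0.
  by move: pv; rewrite !expf_eq0 pos (_ : (0 < _ - j)%N) //; lia.
have [|k'] := vgeo_neq0 _ (index_le j'eta ah).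
  by rewrite mulf_neq0 // expf_neq0.
rewrite /I; case: (i j') => [k1|] //= [<-]; rewrite w_term // lez_nat leq_pmul2l //.
rewrite leq_add2l => le; exists k1 => //; apply: (leq_trans le).
by rewrite leq_add2l leq_mul2r leq_sub2l ?orbT.
Qed.

(** Cost 0 forces h = 0, and then (eta - j) v_E(p) = 0 with v_E(p) > 0. This serves the case x =
    0. *)
Lemma teich_index_eq0 j : (j <= eta)%N -> i j = Some 0%N -> j = eta.
Proof.
move=> jeta /(index_attained jeta)[h [ah vh pv]] /esym/eqP.
rewrite addn_eq0 muln_eq0 => /andP[/eqP h0]; rewrite h0 add0n in vh pv *.
rewrite -/eta subn_eq0 => /orP[ej|/eqP ve0]; first by apply/eqP; rewrite eqn_leq jeta.
apply/eqP; rewrite eqn_leq jeta /= -subn_eq0; move: pv; rewrite -/eta expf_eq0.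
by case: posnP => //= _ /wp_ve[_ [_]]; rewrite ve0.
Qed.

Lemma teich_index_chain : index_chain w p I eta.
Proof.
split=> [j z jeta|j j' z jj'].
  have [p0|p0] := eqVneq (p%:R : F) 0; first by rewrite p0 mul0r => _; apply: vgeo0.
  rewrite /I [i j]i_rec // /v (negPf p0).
  case: (i j.+1) => [k1 /= hz|/= ->]; last by rewrite mulr0; apply: vgeo0.
  have hpz : vge w (p%:R * z) (e * (N + (k1 + ve)))%:Z.
    have [wpE _] := wp_ve p0; have -> : (e * (N + (k1 + ve)))%:Z = w p%:R + (e * (N + k1))%:Z.
      by rewrite wpE; lia.
    by apply: (vgeM hw) => //; apply: vge_w.
  case: (it j) => [t|] //=; apply: vge_le hpz.
  by rewrite lez_nat leq_mul2l leq_add2l geq_minr orbT.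
rewrite /I; case E : (i j) => [k|]; last by move=> /= ->; apply: vgeo0.
have [k' -> le] := teich_index_mono jj' E.
by apply: vge_le; rewrite lez_nat leq_mul2l leq_add2l le orbT.
Qed.

Definition teich_poly T : {poly F} := \sum_(h < T) a h *: 'X^(h + N).

Lemma coef_tay_teich T s : (tay pi (teich_poly T))`_s =
  \sum_(h < T) a h * (('C(h + N, s))%:R * pi ^+ (h + N)).
Proof.
rewrite /tay /teich_poly linear_sum coef_sum; apply: eq_bigr => h _ /=.
rewrite comp_polyZ coefZ comp_Xn_poly exprZn coefZ coef_1DXn.
by rewrite [pi ^+ _ * _]mulrC.
Qed.

(* The minimum defining i_j is attained only once: two h of equal cost differ
   by a multiple of v_E(p), hence of N, while v_p(h + N) <= v_p(N). *)
Lemma teich_has_indices T :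
  (forall j k, (j <= eta)%N -> i j = Some k -> (k < T)%N) ->
  has_indices w p (fun s => (tay pi (teich_poly T))`_s) I eta.
Proof.
move=> hT; split=> [s s0|j k jeta].
  rewrite coef_tay_teich; apply: vgeo_sum => // h _.
  have [->|ah] := eqVneq (a h) 0; first by rewrite mul0r; apply: vgeo0.
  apply: vgeoMl => //; first by right; rewrite ha.
  have [sl|sl] := leqP (logn p s) eta; last first.
    rewrite /I i_eta /=; apply: vgeMl => //; first exact: vge_natr.
    by right; rewrite (wX hw) // wpi; lia.
  case/dvdnP: (dvdn_bin_logn p_pr (h + N) s0) => q ->.
  rewrite natrM natrX -mulrA; apply: vgeoMl => //; first exact: vge_natr.
  exact: index_le.
rewrite /I; case E : (i j) => [k0|] //= [<-] {k}.
have [h [ah vh pv ek0]] := index_attained jeta E.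
have hN h' : (0 < h' + N)%N by rewrite addn_gt0 N_gt0 orbT.
have piX h' : pi ^+ (h' + N) != 0 by rewrite expf_neq0.
(* Cutting at v_p(h + N) makes p^j' a divisor of h + N, so C(h + N, p^j') has valuation v_p(h + N) -
   j' exactly, and leaves the cost of h unchanged. *)
pose j' := minn (logn p (h + N)) j.
have j'eta : (j' <= eta)%N by rewrite geq_min vh.
have ej' : (logn p (h + N) - j' = logn p (h + N) - j)%N.
  by rewrite /j'; clear; lia.
have Ej' : i j' = Some k0.
  have [vj|vj] := leqP j (logn p (h + N)); first by rewrite /j' (minn_idPr vj).
  have j'E : j' = logn p (h + N) by apply/minn_idPl/ltnW.
  have [|k'] := vgeo_neq0 _ (index_le j'eta ah); first by rewrite ej' mulf_neq0.
  rewrite /I -/j'; case E' : (i j') => [k1|] //= [<-]; rewrite w_term ej' //.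
  rewrite lez_nat leq_pmul2l // leq_add2l -ek0 => le.
  have [|k2] := teich_index_mono (j' := j) _ E'; first by rewrite jeta andbT /j' geq_minr.
  by rewrite E => -[<-] le2; congr Some; apply/eqP; rewrite eqn_leq le.
pose t h' := a h' * (('C(h' + N, p ^ j'))%:R * pi ^+ (h' + N)).
have [t0 wt] : t h != 0 /\ w (t h) = (e * (N + k0))%:Z.
  have lc : logn p 'C(h + N, p ^ j') = (logn p (h + N) - j)%N.
    by rewrite logn_bin_pow // ?ej' ?geq_minl.
  have c0 : ('C(h + N, p ^ j'))%:R != 0 :> F.
    apply: (natr_neq0 hw p_pr hp); last by rewrite lc.
    by rewrite bin_gt0 dvdn_leq // pfactor_dvdn ?geq_minl.
  have cp0 := mulf_neq0 c0 (piX h).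
  split; first exact: mulf_neq0.
  rewrite (wM hw ah cp0) (ha ah) add0r ek0 -(w_term h pv) (wM hw c0 (piX h)).
  rewrite (wM hw pv (piX h)); congr (_ + _); rewrite (w_natr hw p_pr hp c0) lc.
  case: (posnP (logn p (h + N) - j)) pv => [-> _|u0]; first by rewrite expr0 (w1 hw) mul0r.
  by rewrite expf_eq0 u0 /= => p0; rewrite (wX hw).
have others h' : h' != h -> vge w (t h') ((e * (N + k0))%:Z + 1).
  move=> hh'; have [ah'|ah'] := eqVneq (a h') 0; first by rewrite /t ah' mul0r; apply: vge0.
  have [c0|c0] := eqVneq (('C(h' + N, p ^ j'))%:R : F) 0.
    by rewrite /t c0 mul0r mulr0; apply: vge0.
  right; set u := logn p 'C(h' + N, p ^ j').
  have pu : p%:R ^+ u != 0 :> F by apply: (natr_logn_neq0 p_pr).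
  have -> : w (t h') = (e * (N + (h' + u * ve)))%:Z.
    rewrite -(w_term h' pu) /t (wM hw ah') ?mulf_neq0 // (ha ah') add0r.
    rewrite (wM hw c0 (piX h')) (wM hw pu (piX h')); congr (_ + _).
    rewrite (w_natr hw p_pr hp c0) -/u; case: (posnP u) pu => [-> _|u0].
      by rewrite expr0 (w1 hw) mul0r.
    by rewrite expf_eq0 u0 /= => p0; rewrite (wX hw).
  suff lt : (k0 < h' + u * ve)%N.
    have : (e * (N + k0).+1 <= e * (N + (h' + u * ve)))%N by rewrite leq_mul2l ltn_add2l lt orbT.
    by rewrite mulnS; move: e_gt0; clear; lia.
  have uv : (logn p (h' + N) - j' <= u)%N.
    have cn : (0 < 'C(h' + N, p ^ j'))%N by case: 'C(_, _) c0 => //; rewrite eqxx.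
    have pj0 : (0 < p ^ j')%N by rewrite expn_gt0 prime_gt0.
    by have := dvdn_bin_logn p_pr (h' + N) pj0; rewrite pfactorK // pfactor_dvdn.
  have le_k0 h1 : a h1 != 0 -> p%:R ^+ (logn p (h1 + N) - j') != 0 :> F ->
      (k0 <= h1 + (logn p (h1 + N) - j') * ve)%N.
    move=> ah1 pv1; have [|k'] := vgeo_neq0 _ (index_le j'eta ah1).
      exact: mulf_neq0.
    by rewrite /I Ej' /= => -[<-]; rewrite w_term // lez_nat leq_pmul2l // leq_add2l.
  have [p0|p0] := eqVneq (p%:R : F) 0.
    have nop r : p%:R ^+ r != 0 :> F -> r = 0%N.
      by case: r => // r; rewrite p0 expr0n eqxx.
    have k0h : k0 = h by rewrite ek0 (nop _ pv) mul0n addn0.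
    move: uv; rewrite (nop _ pu) leqn0 => /eqP uv0.
    have := le_k0 h' ah'; rewrite uv0 expr0 oner_eq0 => /(_ isT).
    by rewrite !mul0n !addn0 k0h leq_eqVlt eq_sym (negPf hh').
  have pX r : p%:R ^+ r != 0 :> F by rewrite expf_neq0.
  have [_ [Nve ve0]] := wp_ve p0.
  have le1 : (k0 <= h' + u * ve)%N.
    by apply: leq_trans (le_k0 h' ah' (pX _)) _; rewrite leq_add2l leq_mul2r uv orbT.
  rewrite ltn_neqAle le1 andbT; apply/negP => /eqP ek'.
  have eqh : (h + (logn p (h + N) - j') * ve = h' + u * ve)%N by rewrite ej' -ek0.
  (* [ve] is a multiple of N, so h and h' of equal cost are congruent modulo p^r for all r <=
     eta. *)
  have dvE r : (r <= eta)%N -> (p ^ r %| h + N)%N = (p ^ r %| h' + N)%N.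
    move=> reta; have rve : (p ^ r %| ve)%N.
      by apply: dvdn_trans Nve; rewrite pfactor_dvdn.
    have d1 := dvdn_mull (logn p (h + N) - j')%N rve; have d2 := dvdn_mull u rve.
    rewrite -[LHS](dvdn_addl _ d1) -[RHS](dvdn_addl _ d2); congr (_ %| _)%N.
    by rewrite addnAC eqh addnAC.
  have vv : (logn p (h + N) <= logn p (h' + N))%N.
    by rewrite -pfactor_dvdn // -dvE // pfactor_dvdnn.
  have uu : (logn p (h + N) - j' <= u)%N by apply: leq_trans uv; rewrite leq_sub2r.
  have h'h : (h' <= h)%N.
    have := leq_mul uu (leqnn ve); rewrite leqNgt => le; rewrite leqNgt.
    by apply/negP => lt; move: le; rewrite -leqNgt; move: eqh lt; clear; lia.
  have : h' = h; last by move: hh' => /[swap] ->; rewrite eqxx.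
  apply/eqP; rewrite eqn_leq h'h /=.
  (* If v_p(h + N) = eta, comparison with the nonzero coefficient a_0 forces h = 0; otherwise h and
     h' have the same v_p, and their costs compare directly. *)
  have [veq|] := eqVneq (logn p (h + N)) eta.
    have := le_k0 0%N a00 (pX _); rewrite !add0n -/eta -veq ej' ek0 -[X in (_ <= X)%N]add0n leq_add2r leqn0.
    by move/eqP ->.
  move=> vne; have vlt : (logn p (h + N) < eta)%N by rewrite ltn_neqAle vne.
  have veq : logn p (h' + N) = logn p (h + N).
    apply/eqP; rewrite eqn_leq vv andbT leqNgt -pfactor_dvdn // -dvE //.
    by rewrite pfactor_dvdn // ltnn.
  have := le_k0 h' ah' (pX _); rewrite veq ej' ek0.
  by rewrite leq_add2r.
have hT0 : (h < T)%N by apply: leq_ltn_trans (hT j k0 jeta E); rewrite ek0 leq_addr.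
have [D0 wD] : (tay pi (teich_poly T))`_(p ^ j') != 0 /\
    w (tay pi (teich_poly T))`_(p ^ j') = (e * (N + k0))%:Z.
  rewrite coef_tay_teich (bigD1 (Ordinal hT0)) //= -wt; apply: vge_dom => //.
  by apply: vge_sum => // h' hh'; rewrite wt; apply: others.
by exists j'; rewrite Ej' geq_minr.
Qed.

End TeichmullerSeries.

Section NatFactor.
Variables (F : fieldType) (w : F -> int) (p : nat).
Hypothesis hw : is_norm_dvaluation w.
Hypothesis p_pr : prime p.
Hypothesis hp : vge w p%:R 1.

Lemma vge_natr_logn n z B : (0 < n)%N -> vge w (n%:R * z) B ->
  vge w (p%:R ^+ logn p n * z) B.
Proof.
move=> n_gt0; have [q cpq eq_n] := pfactor_coprime p_pr n_gt0.
have [q0 wq] := coprime_natr_unit hw p_pr hp cpq.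
rewrite {1}eq_n natrM natrX -mulrA => h.
rewrite -[X in vge _ X](mulKf q0); apply: vgeMl => //.
by right; rewrite (wV hw) // wq.
Qed.

End NatFactor.

(** * Indices read off an Eisenstein polynomial *)

Section EisensteinIndices.
Variables (K : fieldType) (M : fieldExtType K) (w : M -> int) (p : nat).
Hypothesis hw : is_norm_dvaluation w.
Hypothesis p_pr : prime p.
Hypothesis hp : vge w p%:R 1.
Variables n0 e0 : nat.
Hypothesis n0_gt1 : (1 < n0)%N.
Hypothesis e0_gt0 : (0 < e0)%N.
Hypothesis hK : forall y, y \in (1%VS : {vspace M}) -> y != 0 ->
  ((n0 * e0)%:Z %| w y)%Z.
Variable pi : M.
Hypothesis wpi : w pi = e0.
Hypothesis pi0 : pi != 0.
Variable f : {poly M}.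
Hypothesis hf : okpoly w f.
Hypothesis sf : size f = n0.+1.
Hypothesis fN : forall h, (h <= n0)%N -> vge w (f`_h * pi ^+ h) (n0 * e0)%:Z.
Variables (I : nat -> option nat) (nu : nat).
Hypothesis I_nu : I nu = Some (n0 * e0)%N.
Hypothesis hlev : forall j th, (j <= nu)%N ->
  lev w (fun t => (tay pi f)`_t) (p ^ j) th <-> (forall k, I j = Some k -> th <= k%:Z).

Lemma natr_mem1 n : n%:R \in (1%VS : {vspace M}).
Proof. by rewrite -scaler_nat memvZ // mem1v. Qed.

Lemma coef_tay_eisenstein t : (tay pi f)`_t =
  \sum_(h < n0.+1) ('C(h, t))%:R * (f`_h * pi ^+ h).
Proof. by rewrite coef_tay sf; apply: eq_bigr => h _; rewrite mulrC. Qed.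

(** The term h = 0 vanishes; after division by pi the others have exponents 0 to n0 - 1, where no
    cancellation occurs. *)
Lemma vge_coef_tay_terms t th h : (0 < t)%N -> vge w (tay pi f)`_t th ->
  (h <= n0)%N -> vge w (('C(h, t))%:R * (f`_h * pi ^+ h)) th.
Proof.
move=> t0; case: h => [|h] hB hn; first by rewrite bin_small // mul0r; apply: vge0.
pose c k : M := ('C(k.+1, t))%:R * f`_k.+1.
have cK k : c k \in 1%VS by apply: mem1M; [exact: natr_mem1|case: (hf k.+1)].
have : vge w (\sum_(k < n0) c k * pi ^+ k) (th - e0%:Z).
  have -> : \sum_(k < n0) c k * pi ^+ k = (tay pi f)`_t / pi.
    rewrite coef_tay_eisenstein big_ord_recl bin_small // mul0r add0r mulr_suml.
    apply: eq_bigr => k _; rewrite lift0 /c exprSr.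
    by rewrite -!mulrA divff // mulr1.
  by apply: (vgeM hw) => //; right; rewrite (wV hw) // wpi.
move/(vge_power_terms hw n0_gt1 e0_gt0 hK wpi pi0 (fun k _ => cK k)).
move/(_ h hn) => h1.
have -> : ('C(h.+1, t))%:R * (f`_h.+1 * pi ^+ h.+1) = (c h * pi ^+ h) * pi.
  by rewrite /c exprSr !mulrA.
rewrite -[th](subrK e0%:Z); apply: (vgeM hw) => //.
by right; rewrite wpi.
Qed.

(** From minima to single coefficients: a bound on D at p^min(v_p(h), j) bounds p^max(0, v_p(h) - j)
    f_h pi^h ([cost]), which in turn bounds the h-term of every D_t with v_p(t) <= j ([binle]). *)
Lemma eisenstein_has_indices : has_indices w p (fun t => (tay pi f)`_t) I nu.
Proof.
have pj0 j : (0 < p ^ j)%N by rewrite expn_gt0 prime_gt0.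
have cost j h th : (0 < h <= n0)%N -> (j <= nu)%N ->
    vge w (tay pi f)`_(p ^ minn (logn p h) j) th ->
    vge w (p%:R ^+ (logn p h - j) * (f`_h * pi ^+ h)) th.
  move=> /andP[h0 hn] jnu /(vge_coef_tay_terms (pj0 _)) /(_ hn).
  have lv : (p ^ minn (logn p h) j %| h)%N by rewrite pfactor_dvdn // geq_minl.
  move/(vge_natr_logn hw p_pr hp); rewrite bin_gt0 dvdn_leq // logn_bin_pow ?geq_minl //.
  have -> : (logn p h - minn (logn p h) j = logn p h - j)%N by clear; lia.
  exact.
have binle h t j th : (0 < t)%N -> (logn p t <= j)%N ->
    vge w (p%:R ^+ (logn p h - j) * (f`_h * pi ^+ h)) th ->
    vge w (('C(h, t))%:R * (f`_h * pi ^+ h)) th.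
  move=> t0 tj; apply: vge_dvdn => //.
  by apply: dvdn_trans (dvdn_bin_logn p_pr h t0); rewrite dvdn_exp2l // leq_sub2l.
split=> [s s0|j k jnu Ik].
  rewrite coef_tay_eisenstein; apply: vgeo_sum => // -[[|h] hn] _ /=.
    by rewrite bin_small // mul0r; apply: vgeo0.
  have [sn|sn] := leqP (logn p s) nu; last first.
    rewrite I_nu /=; apply: vgeMl => //; first exact: vge_natr.
    exact: fN.
  apply/vgeoP => // th hth; apply: (binle _ _ (logn p s)) => //.
  apply: cost => //; apply: (proj2 (hlev th sn)) => //.
  by rewrite pj0 leq_exp2l ?geq_minr // prime_gt1.
have lk : lev w (fun t => (tay pi f)`_t) (p ^ j) k%:Z.
  by apply/(hlev _ jnu) => k'; rewrite Ik => -[<-].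
have [t [/andP[t0 tj] nt]] : exists t, (0 < t <= p ^ j)%N /\ ~ vge w (tay pi f)`_t (k%:Z + 1).
  apply: contrapT => nex.
  have : lev w (fun t => (tay pi f)`_t) (p ^ j) (k%:Z + 1).
    by move=> t ht; apply: contrapT => nt; apply: nex; exists t.
  by move/(hlev _ jnu)/(_ k Ik); clear; lia.
have lt : (logn p t <= j)%N by apply: (logn_leq_of_expn p_pr t0 (leqnn t) tj).
have [h [hn nh]] : exists h, (0 < h <= n0)%N /\
    ~ vge w (('C(h, t))%:R * (f`_h * pi ^+ h)) (k%:Z + 1).
  apply: contrapT => nex; apply: nt; rewrite coef_tay_eisenstein.
  apply: vge_sum => // -[[|h] hn] _ /=; first by rewrite bin_small // mul0r; apply: vge0.
  by apply: contrapT => nh; apply: nex; exists h.+1.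
(* By [cost] and [binle], an h-term missing the bound k + 1 makes D miss it already at p^j'. *)
pose j' := minn (logn p h) j.
have j'j : (j' <= j)%N by apply: geq_minr.
have j'nu := leq_trans j'j jnu.
have nD : ~ vge w (tay pi f)`_(p ^ j') (k%:Z + 1).
  by move=> hD; apply/nh/(binle _ _ j) => //; apply: cost.
have p1 := prime_gt1 p_pr.
have D_ge : vge w (tay pi f)`_(p ^ j') k%:Z by apply: lk; rewrite pj0 leq_exp2l.
have /vgeNP[D0 Dlt] := nD; have Dk := vge_neq0 D0 D_ge.
exists j'; split=> //; last by move: Dlt Dk; clear; lia.
have [k' Ik' k'k] : exists2 k', I j' = Some k' & k'%:Z < k%:Z + 1.
  apply: contrapT => nex; apply: nD.
  have : lev w (fun t => (tay pi f)`_t) (p ^ j') (k%:Z + 1).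
    apply/(hlev _ j'nu) => k' Ik'; rewrite leNgt; apply/negP => lt'.
    by apply: nex; exists k'.
  by apply; rewrite pj0 leqnn.
have : k%:Z <= k'%:Z.
  have : lev w (fun t => (tay pi f)`_t) (p ^ j') k%:Z.
    by move=> t' /andP[t'0 t'j]; apply: lk; rewrite t'0 (leq_trans t'j) // leq_exp2l.
  by move/(hlev _ j'nu)/(_ _ Ik').
by rewrite Ik' => kk'; congr Some; move: k'k kk'; clear; lia.
Qed.

End EisensteinIndices.

(** * Polynomial data of a single extension *)

Section UnpackIndices.
Variables (K : fieldType) (M : fieldExtType K) (w : M -> int) (p : nat).
Hypothesis hw : is_norm_dvaluation w.
Hypothesis p_pr : prime p.
Hypothesis hp : vge w p%:R 1.
Variables (F E : {vspace M}) (e N : nat) (i : nat -> option nat).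
Hypothesis e_gt0 : (0 < e)%N.
Hypothesis N_gt0 : (0 < N)%N.
Hypothesis hteich : forall t, teich p F t -> okc w t.
Hypothesis wp_dvd : p%:R != 0 :> M -> ((e * N)%:Z %| w p%:R)%Z.
Hypothesis hi : is_indices w p F E e N i.

(** The uniformizers are fixed before the precision B; only the truncation P of the series depends
    on B. *)
Lemma indices_spec :
  let eta := logn p N in
  let I j := omap (fun k => e * (N + k))%N (i j) in
  [/\ i eta = Some 0%N,
      forall j, (j <= eta)%N -> i j = Some 0%N -> j = eta,
      forall j j' k, (j <= j' <= eta)%N -> i j = Some k ->
        exists2 k', i j' = Some k' & (k' <= k)%N,
      index_chain w p I eta &
      exists piF piE, [/\ [/\ piF \in F, piF != 0 & w piF = (e * N)%:Z],
        [/\ piE \in E, piE != 0 & w piE = e%:Z] &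
        forall B, exists P : {poly M}, [/\ okpoly w P,
          forall r, (r < N)%N -> P`_r = 0, vge w (P.[piE] - piF) B &
          has_indices w p (fun t => (tay piE P)`_t) I eta]]].
Proof.
move=> eta I.
case: hi => piF [piE [a [it [[piFF wF] [piEE wE] [F0 E0] ha [hlim hit ieta irec]]]]].
have wa h : a h != 0 -> w (a h) = 0 by apply: (teich_unit hw p_pr (ha h)).
(* Otherwise all terms of the series would have valuation above e N = w piF. *)
have a0 : a 0%N != 0.
  apply/negP => /eqP a0; have [N0 hN0] := hlim ((e * N)%:Z + 1).
  have := hN0 N0.+1 (leqnSn _).
  have : vge w (\sum_(h < N0.+1) a h * piE ^+ (h + N)) ((e * N)%:Z + 1).
    apply: vge_sum => // -[[|h] hh] _ /=; first by rewrite a0 mul0r; apply: vge0.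
    apply: vgeMl => //; first by case: (hteich (ha h.+1)).
    right; rewrite (wX hw) // wE.
    by rewrite -PoszM; move: e_gt0; clear; nia.
  move=> h1 /(vgeD hw h1); rewrite addrC subrK => /(vge_neq0 F0); rewrite wF.
  by clear; lia.
split=> //.
- exact: (teich_index_eq0 p_pr hp e_gt0 N_gt0 E0 wE a0 wp_dvd hit ieta irec).
- exact: (teich_index_mono hw p_pr hp e_gt0 N_gt0 E0 wE a0 wp_dvd hit ieta irec).
- exact: (teich_index_chain hw p_pr hp e_gt0 N_gt0 E0 wE a0 wp_dvd hit ieta irec).
exists piF, piE; split=> // B.
have [N0 hN0] := hlim B.
(* Long enough for the precision B and for every h attaining a finite index, since h <= i_j. *)
pose T := maxn N0 (\max_(j < eta.+1) (odflt 0%N (i j))).+1.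
exists (teich_poly N a T); split.
- rewrite /teich_poly => r; rewrite coef_sum; apply: okc_sum => // h _.
  by rewrite coefZ; apply: okcM => //; [apply: hteich|apply: okpolyXn].
- move=> r rN; rewrite /teich_poly coef_sum big1 // => h _.
  by rewrite coefZ coefXn (ltn_eqF (ltn_addl _ rN)) mulr0.
- apply: vgeBC => //; have := hN0 T (leq_maxl _ _).
  congr (vge _ (_ - _) _); rewrite /teich_poly horner_sum.
  by apply: eq_bigr => h _; rewrite hornerZ hornerXn.
apply: (teich_has_indices hw p_pr hp e_gt0 N_gt0 E0 wE wa a0 wp_dvd hit ieta irec).
move=> j k jeta Ek; rewrite /T leq_max; apply/orP; right; rewrite ltnS.
have -> : k = odflt 0%N (i j) by rewrite Ek.
exact: (leq_bigmax (Ordinal (_ : j < eta.+1)%N)).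
Qed.

End UnpackIndices.

(** * Coefficients of a composed expansion *)

Section Composition.
Variables (F : fieldType) (w : F -> int) (p : nat).
Hypothesis hw : is_norm_dvaluation w.
Hypothesis p_pr : prime p.
Variables (A y : {poly F}) (I J : nat -> option nat) (nu mu : nat).
Hypothesis y0 : y`_0 = 0.
Hypothesis yint : ipoly w y.
Hypothesis hI : index_chain w p I nu.
Hypothesis hA : has_indices w p (fun j => A`_j) I nu.
Hypothesis hy : has_indices w p (fun k => y`_k) J mu.

(* The binomial factor N makes up for the difference between I at v_p(j) and at
   the possibly smaller c = min_k v_p(m_k). *)
Lemma composition_term_bound D (m : nat -> nat) (N j : nat) : (0 < j)%N ->
  (\sum_(k < D) m k = j)%N -> (forall k, (k < D)%N -> (j %| N * m k)%N) ->
  A`_j * (N%:R * \prod_(k < D) y`_k ^+ m k) != 0 ->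
  exists c, [/\ (c <= nu)%N, (forall k, (k < D)%N -> (p ^ c %| m k)%N) &
    forall k, (k < D)%N -> (0 < m k)%N -> (0 < k)%N /\
      exists a b, [/\ I c = Some a, J (minn (logn p k) mu) = Some b &
        (a + p ^ c * b)%:Z <= w (A`_j * (N%:R * \prod_(k < D) y`_k ^+ m k))]].
Proof.
move=> j0 ej dv nz.
have /andP[Aj0] : (A`_j != 0) && (N%:R * \prod_(k < D) y`_k ^+ m k != 0).
  by rewrite -negb_or -mulf_eq0.
rewrite mulf_eq0 negb_or => /andP[N0 P0].
have Ngt0 : (0 < N)%N by case: N N0 {nz dv} => //; rewrite eqxx.
have [k0 mk0] : exists k : 'I_D, (0 < m k)%N.
  apply: contrapT => nex; move: j0; rewrite -ej big1 // => k _.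
  by apply/eqP; rewrite -leqn0 leqNgt; apply/negP => h; apply: nex; exists k.
case: (@arg_minnP _ k0 (fun k : 'I_D => (0 < m k)%N) (fun k : 'I_D => logn p (m k)) mk0).
move=> ks mks hks; set cs := logn p (m ks) in hks.
have pcs k : (k < D)%N -> (p ^ cs %| m k)%N.
  move=> kD; case: (posnP (m k)) => [->|mk]; first exact: dvdn0.
  by rewrite pfactor_dvdn // (hks (Ordinal kD)).
have csj : (cs <= logn p j)%N.
  by rewrite -pfactor_dvdn // -ej; apply: dvdn_sum => k _; apply: pcs.
have logN : (logn p j <= logn p N + cs)%N.
  rewrite /cs -lognM // -pfactor_dvdn ?muln_gt0 ?Ngt0 //.
  by apply: dvdn_trans (dv ks (ltn_ord ks)); rewrite pfactor_dvdnn.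
pose c := minn cs nu; have c_nu : (c <= nu)%N by rewrite geq_minr.
have pc k : (k < D)%N -> (p ^ c %| m k)%N.
  by move=> kD; apply: dvdn_trans (pcs k kD); rewrite dvdn_exp2l // geq_minl.
pose a' := minn (logn p j) nu.
have hAN : vgeo w (A`_j * N%:R) (I c).
  have pN : (p ^ (a' - c) %| N)%N.
    by rewrite pfactor_dvdn //; move: csj logN; rewrite /a' /c; clear; lia.
  case/dvdnP: pN => q ->; rewrite natrM natrX mulrC -mulrA.
  apply: vgeoMl => //; first exact: vge_natr.
  apply: (index_chain_expn hI); last by case: hA => lo _; apply: lo.
  by rewrite geq_minr andbT /a' /c; move: csj; clear; lia.
exists c; split=> // k kD mk.
have k_gt0 : (0 < k)%N.
  case: k kD mk => // kD mk; move: P0.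
  by rewrite (bigD1 (Ordinal kD)) //= y0 expr0n (gtn_eqF mk) mul0r eqxx.
move: P0; rewrite (bigD1 (Ordinal kD)) //= mulf_eq0 negb_or => /andP[yk R0].
have yk0 : y`_k != 0 by move: yk; rewrite expf_eq0 mk.
have [a Ia wa] := vgeo_neq0 (mulf_neq0 Aj0 N0) hAN.
have [b Jb wb] := vgeo_neq0 yk0 (proj1 hy k k_gt0).
split=> //; exists a, b; split=> //.
rewrite mulrA (wM hw) ?mulf_neq0 // PoszD; apply: lerD => //.
rewrite (wM hw) // (wX hw) //.
have wR : 0 <= w (\prod_(i < D | i != Ordinal kD) y`_i ^+ m i).
  by apply: (vge_neq0 R0); apply: vge_prod => // i _; apply: (vgeX0 hw); apply: yint.
rewrite -[X in X <= _]addr0; apply: lerD => //.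
have lem : (p ^ c <= m k)%N by apply: dvdn_leq => //; apply: pc.
apply: (@le_trans _ _ ((m k)%:Z * b%:Z)); first by rewrite -PoszM lez_nat leq_mul2r lem orbT.
by rewrite ler_wpM2l.
Qed.

(** Says that v(z) is at least the minimum of I_c + p^c J_k over p^(c + k) <= s, in a form closed
    under addition as [multinomial_coef] requires. *)
Let T s (z : F) := z = 0 \/ exists c k a b, [/\ (c <= nu)%N, (k <= mu)%N,
  (p ^ (c + k) <= s)%N, I c = Some a /\ J k = Some b & (a + p ^ c * b)%:Z <= w z].

Let TD s x z : T s x -> T s z -> T s (x + z).
Proof.
have [->|x0] := eqVneq x 0; first by rewrite add0r.
have [->|z0] := eqVneq z 0; first by rewrite addr0.
have [->|xz0] := eqVneq (x + z) 0; first by left.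
case=> [xE|[c [k [a [b [h1 h2 h3 h4 hx]]]]]]; first by rewrite xE eqxx in x0.
case=> [zE|[c' [k' [a' [b' [h1' h2' h3' h4' hz]]]]]]; first by rewrite zE eqxx in z0.
right; have [le|le] := leP (w x) (w z).
  exists c, k, a, b; split=> //; apply: (le_trans hx); apply: vge_neq0 => //.
  by apply: vgeD => //; right.
exists c', k', a', b'; split=> //; apply: (le_trans hz); apply: vge_neq0 => //.
by apply: vgeD => //; right=> //; apply: ltW.
Qed.

(** If y_k occurs with exponent m_k > 0, then p^c divides m_k, whence p^(c + v_p(k)) <= k m_k <=
    s. *)
Lemma composition_lower s : (0 < s)%N -> (A \Po y)`_s = 0 \/
  exists c k a b, [/\ (c <= nu)%N, (k <= mu)%N, (p ^ (c + k) <= s)%N,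
    I c = Some a /\ J k = Some b & (a + p ^ c * b)%:Z <= w (A \Po y)`_s].
Proof.
move=> s0; rewrite coef_comp_X0 //; elim/big_ind: _ => [|x z|[[|j] hj] _ /=].
- by left.
- exact: TD.
- by left; rewrite expr0 coef1 (gtn_eqF s0) mulr0.
pose D := size y; pose T' z := T s (A`_j.+1 * z).
suff : T' ((y ^+ j.+1)`_s) by [].
have := @multinomial_coef F T' D (fun k => y`_k) D j.+1 s.
rewrite ltnn subr0 /= coefK; apply.
- by left; rewrite mulr0.
- by move=> x z hx hz; rewrite /T' mulrDr; apply: TD.
move=> m N e1 e2 dv _; rewrite /T'.
have [->|nz] := eqVneq (A`_j.+1 * (N%:R * \prod_(k < D) y`_k ^+ m k)) 0; first by left.
have [c [c_nu pc hc]] := composition_term_bound (ltn0Sn j) e1 dv nz.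
have [k mk] : exists k : 'I_D, (0 < m k)%N.
  apply: contrapT => nex; move: (ltn0Sn j); rewrite -e1 big1 // => k _.
  by apply/eqP; rewrite -leqn0 leqNgt; apply/negP => h; apply: nex; exists k.
have [k0 [a [b [Ia Jb le]]]] := hc k (ltn_ord k) mk.
right; exists c, (minn (logn p k) mu), a, b; split=> //; first exact: geq_minr.
have h1 : (p ^ c <= m k)%N by apply: dvdn_leq => //; apply: pc.
have h2 : (p ^ minn (logn p k) mu <= k)%N.
  by apply: dvdn_leq => //; rewrite pfactor_dvdn // geq_minl.
rewrite expnD mulnC; apply: (leq_trans (leq_mul h2 h1)).
by rewrite -e2 (bigD1 k) //= leq_addr.
Qed.

(** Any multinomial term of valuation at most V yields a pair, which must be (j0, k0). Then p^j0
    divides m_k and p^k0 divides k whenever m_k > 0, and sum k m_k = p^(j0 + k0) leaves only the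
    power p^j0 of the variable of index p^k0. *)
Lemma composition_exact j0 k0 a0 b0 : (j0 <= nu)%N -> (k0 <= mu)%N ->
  I j0 = Some a0 -> J k0 = Some b0 ->
  (forall c k a b, (c <= nu)%N -> (k <= mu)%N -> (c + k <= j0 + k0)%N ->
     I c = Some a -> J k = Some b -> (a + p ^ c * b <= a0 + p ^ j0 * b0)%N ->
     c = j0 /\ k = k0) ->
  (A \Po y)`_(p ^ (j0 + k0)) != 0 /\
  w (A \Po y)`_(p ^ (j0 + k0)) = (a0 + p ^ j0 * b0)%:Z.
Proof.
move=> j0nu k0mu Ij0 Jk0 huniq.
have p1 := prime_gt1 p_pr.
have pgt0 r : (0 < p ^ r)%N by rewrite expn_gt0 ltnW.
set s := (p ^ (j0 + k0))%N; pose V := (a0 + p ^ j0 * b0)%N.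
(* I_j0 is attained at p^j' for some j' <= j0; the pair (j', k0) is no worse than (j0, k0), so
   uniqueness gives j' = j0. *)
have [A0 wA] : A`_(p ^ j0) != 0 /\ w A`_(p ^ j0) = a0%:Z.
  have [j' [j'j Ij' A0 wA]] := proj2 hA j0 a0 j0nu Ij0.
  have [|//|<- _] := huniq j' k0 a0 b0 (leq_trans j'j j0nu) k0mu _ Ij' Jk0 _.
  - by rewrite leq_add2r.
  - by rewrite leq_add2l leq_mul2r leq_exp2l // j'j orbT.
  - by split.
have [Y0 wY] : y`_(p ^ k0) != 0 /\ w y`_(p ^ k0) = b0%:Z.
  have [k' [k'k Jk' Y0 wY]] := proj2 hy k0 b0 k0mu Jk0.
  have [|//|_ <-] := huniq j0 k' a0 b0 j0nu (leq_trans k'k k0mu) _ Ij0 Jk' _.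
  - by rewrite leq_add2l.
  - by split.
pose kap := (p ^ k0)%N; pose D := size y.
have kapD : (kap < D)%N.
  by rewrite ltnNge; apply: contra Y0 => h; rewrite nth_default.
have ekap : (kap * p ^ j0 = s)%N by rewrite /s expnD mulnC.
have term_small (m : nat -> nat) N j : (0 < j)%N -> (\sum_(k < D) m k = j)%N ->
    (\sum_(k < D) k * m k = s)%N -> (forall k, (k < D)%N -> (j %| N * m k)%N) ->
    (j = (p ^ j0)%N -> m kap <> j) ->
    vge w (A`_j * (N%:R * \prod_(k < D) y`_k ^+ m k)) (V%:Z + 1).
  move=> j_gt0 e1 e2 dv njk.
  have [->|nz] := eqVneq (A`_j * (N%:R * \prod_(k < D) y`_k ^+ m k)) 0; first exact: vge0.
  apply: contrapT => /vgeNP[_ lt].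
  have [c [c_nu pc hc]] := composition_term_bound j_gt0 e1 dv nz.
  have key k : (k < D)%N -> (0 < m k)%N ->
      [/\ (0 < k)%N, (p ^ j0 %| m k)%N & (p ^ k0 %| k)%N].
    move=> kD mk; have [k_gt0 [a [b [Ia Jb le]]]] := hc k kD mk.
    have h1 : (p ^ c <= m k)%N by apply: dvdn_leq => //; apply: pc.
    have h2 : (p ^ minn (logn p k) mu <= k)%N.
      by apply: dvdn_leq => //; rewrite pfactor_dvdn // geq_minl.
    have kms : (k * m k <= s)%N by rewrite -e2 (bigD1 (Ordinal kD)) //= leq_addr.
    have [||ec ek] := huniq c (minn (logn p k) mu) a b c_nu (geq_minr _ _) _ Ia Jb _.
    - rewrite -(leq_exp2l _ _ p1) -/s expnD mulnC.
      exact: leq_trans (leq_mul h2 h1) kms.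
    - by rewrite -lez_nat -ltzD1 -/V; apply: le_lt_trans lt.
    split=> //; first by rewrite -ec; apply: pc.
    by rewrite pfactor_dvdn // -ek geq_minl.
  have [k1 mk1] : exists k : 'I_D, (0 < m k)%N.
    apply: contrapT => nex; move: j_gt0; rewrite -e1 big1 // => k _.
    by apply/eqP; rewrite -leqn0 leqNgt; apply/negP => h; apply: nex; exists k.
  have [k1_gt0 pm1 pk1] := key k1 (ltn_ord k1) mk1.
  have lem1 := dvdn_leq mk1 pm1; have lek1 := dvdn_leq k1_gt0 pk1.
  have split_s : (k1 * m k1 + \sum_(k < D | k != k1) k * m k = s)%N.
    by rewrite -e2 [RHS](bigD1 k1).
  have les : (s <= k1 * m k1)%N by rewrite -ekap; apply: leq_mul.
  have km1 : (k1 * m k1 = s)%N by move: split_s les; clear; lia.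
  have rest0 : (\sum_(k < D | k != k1) k * m k = 0)%N by move: split_s km1; clear; lia.
  have m0 (k : 'I_D) : k != k1 -> m k = 0%N.
    move=> kk1; case: (posnP (m k)) => // mk.
    have [k_gt0 _ _] := key k (ltn_ord k) mk.
    by move/eqP: rest0; rewrite (bigD1 k) //= addn_eq0 muln_eq0 (gtn_eqF mk) (gtn_eqF k_gt0).
  have ej : j = m k1.
    by rewrite -e1 (bigD1 k1) //= big1 ?addn0 // => k /m0.
  have ek1 : k1 = kap :> nat.
    apply/eqP; rewrite eqn_leq lek1 andbT -(leq_pmul2r (pgt0 j0)) ekap -km1.
    by rewrite leq_pmul2l.
  have em1 : m k1 = (p ^ j0)%N.
    apply/eqP; rewrite eqn_leq lem1 andbT -(leq_pmul2l (pgt0 k0)) -/kap ekap -km1.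
    by rewrite leq_pmul2r.
  by apply: njk; rewrite ej ?em1 // -ek1.
have js (j : nat) : (j < s.+1)%N -> j != (p ^ j0)%N -> vge w (A`_j * (y ^+ j)`_s) (V%:Z + 1).
  case: j => [|j] hj nj; first by rewrite expr0 coef1 (gtn_eqF (pgt0 _)) mulr0; apply: vge0.
  have := @multinomial_coef F (fun z => vge w (A`_j.+1 * z) (V%:Z + 1)) D (fun k => y`_k) D j.+1 s.
  rewrite ltnn subr0 /= coefK; apply.
  - by rewrite mulr0; apply: vge0.
  - by move=> x z hx hz; rewrite mulrDr; apply: vgeD.
  - move=> m N e1 e2 dv _; apply: term_small => // ej.
    by rewrite ej eqxx in nj.
have main : vge w (A`_(p ^ j0) * ((y ^+ (p ^ j0))`_s - y`_kap ^+ (p ^ j0))) (V%:Z + 1).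
  have := @multinomial_coef F (fun z => vge w (A`_(p ^ j0) * z) (V%:Z + 1)) D (fun k => y`_k) kap (p ^ j0)%N s.
  rewrite kapD ekap eqxx /= coefK; apply.
  - by rewrite mulr0; apply: vge0.
  - by move=> x z hx hz; rewrite mulrDr; apply: vgeD.
  - by move=> m N e1 e2 dv /(_ isT) nm; apply: term_small.
have hs : (p ^ j0 < s.+1)%N by rewrite ltnS /s leq_exp2l // leq_addr.
pose mt := A`_(p ^ j0) * y`_kap ^+ (p ^ j0).
have yX : y`_kap ^+ (p ^ j0) != 0 by rewrite expf_neq0.
have wmt : w mt = V%:Z.
  by rewrite (wM hw A0 yX) (wX hw _ Y0) wA wY -PoszM -PoszD.
have mt0 : mt != 0 by apply: mulf_neq0.
rewrite coef_comp_X0 // (bigD1 (Ordinal hs)) //=.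
have -> : A`_(p ^ j0) * (y ^+ (p ^ j0))`_s =
  mt + A`_(p ^ j0) * ((y ^+ (p ^ j0))`_s - y`_kap ^+ (p ^ j0)).
  by rewrite /mt; ring.
rewrite -addrA -/V -wmt; apply: vge_dom => //; rewrite wmt.
apply: vgeD => //; apply: vge_sum => // i ni; apply: js => //.
Qed.

End Composition.

Section Expansions.
Variables (K : fieldType) (M : fieldExtType K) (w : M -> int).
Hypothesis hw : is_norm_dvaluation w.
Variables (E : {subfield M}) (n0 e0 : nat).
Hypothesis hdim : \dim E = n0.
Hypothesis n0_gt1 : (1 < n0)%N.
Hypothesis e0_gt0 : (0 < e0)%N.
Hypothesis hK : forall y, y \in (1%VS : {vspace M}) -> y != 0 ->
  ((n0 * e0)%:Z %| w y)%Z.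

(* P(pi) = c up to valuation B, where c is 0 (P Eisenstein-like) or a
   uniformizer of K (P without terms of low degree). *)
Definition expands (B : int) (P : {poly M}) (pi c : M) : Prop :=
  [/\ okpoly w P, [/\ pi \in E, w pi = e0%:Z & pi != 0], c \in 1%VS,
      vge w (P.[pi] - c) B &
      [/\ P`_0 - c != 0, w (P`_0 - c) = (n0 * e0)%:Z & vge w P`_1 1]].

Lemma lev_expands B P1 P2 pi1 pi2 c1 c2 s th :
  (n0 * e0)%:Z < B -> th <= B -> expands B P1 pi1 c1 -> expands B P2 pi2 c2 ->
  lev w (fun t => (tay pi1 P1)`_t) s th <-> lev w (fun t => (tay pi2 P2)`_t) s th.
Proof.
move=> NB thB [ok1 [pi1E w1 pi10] c1K hB1 [d1 wd1 l1]].
move=> [ok2 [pi2E w2 pi20] c2K hB2 [d2 wd2 l2]].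
split.
  exact: (lev_transfer hw hdim n0_gt1 e0_gt0 hK ok1 ok2 pi1E w1 pi10 pi2E w2
    pi20 c1K c2K thB NB hB1 hB2 d1 wd1 l1).
exact: (lev_transfer hw hdim n0_gt1 e0_gt0 hK ok2 ok1 pi2E w2 pi20 pi1E w1
  pi10 c2K c1K thB NB hB2 hB1 d2 wd2 l2).
Qed.

Lemma expands_uniformizer B P pi c : okpoly w P -> pi \in E -> w pi = e0 ->
  pi != 0 -> c \in 1%VS -> c != 0 -> w c = (n0 * e0)%:Z ->
  (forall r, (r < n0)%N -> P`_r = 0) -> vge w (P.[pi] - c) B -> expands B P pi c.
Proof.
move=> okP piE wpi pi0 cK c0 wc lowP hB.
split=> //; rewrite !lowP ?(ltnW n0_gt1) // sub0r oppr_eq0 (wN hw).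
by split=> //; apply: vge0.
Qed.

End Expansions.

(** * The tower M/L/K *)

Section Tower.
Variables (p : nat) (K : fieldType).
Variables (M : fieldExtType K) (L : {subfield M}) (w : M -> int) (n m : nat).
Variables (iLK iML iMK : nat -> option nat).
Hypothesis p_pr : prime p.
Hypothesis hw : is_norm_dvaluation w.
Hypothesis hcomp : complete_in w 1%VS.
Hypothesis hp : vge w p%:R 1.
Hypothesis n_gt1 : (1 < n)%N.
Hypothesis m_gt1 : (1 < m)%N.
Hypothesis dimL : \dim L = n.
Hypothesis dimM : \dim {:M} = (n * m)%N.
Hypothesis hK : forall y, y \in (1%VS : {vspace M}) -> y != 0 ->
  ((n * m)%:Z %| w y)%Z.
Hypothesis hLK : is_indices w p 1%VS L m n iLK.
Hypothesis hML : is_indices w p L fullv 1 m iML.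
Hypothesis hMK : is_indices w p 1%VS fullv 1 (n * m) iMK.
Let nu := logn p n.
Let mu := logn p m.
Let ILK j := omap (fun k => m * (n + k))%N (iLK j).

Let n_gt0 : (0 < n)%N := ltnW n_gt1.
Let m_gt0 : (0 < m)%N := ltnW m_gt1.
Let nm_gt1 : (1 < n * m)%N.
Proof. by apply: leq_trans n_gt1 _; rewrite leq_pmulr. Qed.
Let nm_gt0 : (0 < n * m)%N := ltnW nm_gt1.
Let hK1 y : y \in (1%VS : {vspace M}) -> y != 0 -> ((n * m * 1)%:Z %| w y)%Z.
Proof. by rewrite muln1; apply: hK. Qed.
Let teich_ok F t : teich p F t -> okc w t.
Proof. exact: (teich_okc hw p_pr hp hcomp dimM nm_gt1 hK). Qed.
Let wp_dvd d : (d %| n * m)%N -> (p%:R : M) != 0 -> (d%:Z %| w p%:R)%Z.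
Proof.
move=> dd p0; apply: dvdz_trans (hK (natr_mem1 M p) p0).
by rewrite dvdzE /= .
Qed.

Let LK_spec : _ := indices_spec hw p_pr hp m_gt0 n_gt0 (@teich_ok _)
  (@wp_dvd (m * n)%N ltac:(by rewrite mulnC)) hLK.
Let ML_spec : _ := indices_spec hw p_pr hp (ltn0Sn 0) m_gt0 (@teich_ok _)
  (@wp_dvd (1 * m)%N ltac:(by rewrite mul1n dvdn_mull)) hML.
Let MK_spec : _ := indices_spec hw p_pr hp (ltn0Sn 0) nm_gt0 (@teich_ok _)
  (@wp_dvd (1 * (n * m))%N ltac:(by rewrite mul1n)) hMK.

Lemma base_index_chain : index_chain w p ILK nu.
Proof. by case: LK_spec. Qed.

(** The data of L/K come with another uniformizer. Only the minima carry over to [piL];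
    [eisenstein_has_indices] refines them again. *)
Lemma eisenstein_indices (piL : M) : piL \in L -> w piL = m -> piL != 0 ->
  exists f : {poly M}, [/\ okpoly w f, f.[piL] = 0,
    f`_0 != 0 /\ w f`_0 = (n * m)%:Z &
    has_indices w p (fun t => (tay piL f)`_t) ILK nu].
Proof.
move=> piLL wL L0.
have [f [okf _ sf f0 [wf0 f00 hfi]]] := eisenstein hw n_gt1 m_gt0 hK wL L0 dimL piLL.
exists f; split=> //; have [ieta _ _ hchain] := LK_spec.
move=> [piK [pi [[piKK K0 wK] [piL' pi0 wpi] hP]]].
have wKE : w piK = (n * m)%:Z by rewrite wK mulnC.
apply: (eisenstein_has_indices hw p_pr hp n_gt1 m_gt0 hK wL L0 okf sf).
- move=> h; rewrite leq_eqVlt => /orP[/eqP ->|hn].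
    apply: vgeMl => //; first by case: (okf n).
    by right; rewrite (wX hw) // wL -PoszM.
  by apply: vgeMr => //; [exact: hfi|apply: vgeX0 => //; right; rewrite wL].
- by rewrite /ILK ieta /= addn0 mulnC.
move=> j th jnu; pose B := Num.max th ((n * m)%:Z + 1).
have [P [okP lowP PpiB hPI]] := hP B.
have NB : (n * m)%:Z < B by rewrite lt_max ltzD1 lexx orbT.
have thB : th <= B by rewrite le_max lexx.
rewrite -(lev_indices p_pr th hchain hPI jnu).
apply: (lev_expands hw dimL n_gt1 m_gt0 hK (B := B) (c1 := 0) (c2 := piK)) => //.
- split; rewrite ?mem0v ?f0 ?subr0 //; first exact: vge0.
  by split=> //; apply: vge_le (hfi 1%N n_gt1); rewrite lez_nat.
- exact: (expands_uniformizer hw).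
Qed.

(** A expands f at [piL], y is the relative expansion of G at [piM]. As G(piM) is close to [piL],
    A(y) agrees up to precision with the expansion of f o G, which has the same minima as the
    truncated series H of M/K. *)
Lemma tower_comparison (B : int) : exists A y : {poly M},
  [/\ y`_0 = 0, ipoly w y, has_indices w p (fun j => A`_j) ILK nu,
      has_indices w p (fun k => y`_k) iML mu &
      forall j th, (j <= logn p (n * m))%N -> th <= B ->
        lev w (fun t => (A \Po y)`_t) (p ^ j) th <->
        (forall k, iMK j = Some k -> th <= (n * m + k)%:Z)].
Proof.
have [_ _ _ _ [piL [piM [[piLL L0 wL] [_ M0 wM1] hG]]]] := ML_spec.
rewrite mul1n in wL.
have [_ _ _ hchain [piK [pi' [[piKK K0 wK] [_ pi'0 wpi'] hH]]]] := MK_spec.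
rewrite mul1n in wK.
have [f [okf f0 [f00 wf0] hA]] := eisenstein_indices piLL wL L0.
pose B' := Num.max B ((n * m)%:Z + 1).
have NB : (n * m)%:Z < B' by rewrite lt_max ltzD1 lexx orbT.
have NB1 : (n * m * 1)%:Z < B' by rewrite muln1.
have [G [okG lowG GB hGI]] := hG B'.
have [H [okH lowH HB hHI]] := hH B'.
have mB : m%:Z + 1 <= B'.
  have : (m <= n * m)%N by rewrite leq_pmull.
  by move: NB; clear; lia.
have [pit0 wpit] : G.[piM] != 0 /\ w G.[piM] = m.
  rewrite -(subrK piL G.[piM]) addrC -wL; apply: vge_dom => //.
  by rewrite wL; apply: vge_le GB.
have vM : vge w piM 0 by right; rewrite wM1.
have vL : vge w piL 0 by right; rewrite wL.
have vpit : vge w G.[piM] 0 by right; rewrite wpit.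
pose y := eta piM G; pose A := tay piL f.
have y0 : y`_0 = 0 by apply: eta0.
(* Division by G(piM), of valuation m, removes the summand m from m + i_k. *)
have yE k o : (0 < k)%N -> vgeo w (tay piM G)`_k (omap (fun k => 1 * (m + k))%N o) ->
    vgeo w y`_k o.
  move=> k0; rewrite /y coef_eta //; case: o => [b|/= ->]; last by rewrite mul0r.
  rewrite /= mul1n => h; rewrite -[b%:Z](addKr m%:Z) addrC.
  by apply: (vgeM hw) => //; right; rewrite (wV hw) // wpit.
have yint : ipoly w y.
  move=> [|k]; first by rewrite y0; apply: vge0.
  have := yE k.+1 _ (ltn0Sn k) (proj1 hGI _ (ltn0Sn k)).
  by apply: vgeo_vge => b _.
have okfi := okpoly_ipoly okf.
have hy : has_indices w p (fun k => y`_k) iML mu.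
  split=> [k k0|j k jmu Ek]; first by apply: yE => //; apply: (proj1 hGI).
  have [|j' [j'j Ej' D0 wD]] := proj2 hGI j (1 * (m + k))%N jmu; first by rewrite Ek.
  exists j'; have pj' : (0 < p ^ j')%N by rewrite expn_gt0 prime_gt0.
  move: Ej'; case: (iML j') => [k'|] //= [/eqP]; rewrite !mul1n eqn_add2l => /eqP ->.
  rewrite /y coef_eta //; split=> //; first by rewrite mulf_neq0 ?invr_neq0.
  by rewrite (wM hw) ?invr_neq0 // (wV hw) // wD wpit mul1n PoszD addrAC subrr add0r.
exists A, y; split=> // j th jle thB.
have thB' : th <= B' by rewrite le_max thB.
have eH := lev_indices p_pr th hchain hHI jle.
have G0 : G`_0 = 0 by apply: lowG.
(* G starts in degree m >= 2, so f o G has constant term f_0 and no linear term. *)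
have exp1 : expands w fullv (n * m) 1 B' (f \Po G) piM 0.
  have c0 : (f \Po G)`_0 = f`_0.
    by rewrite -horner_coef0 horner_comp horner_coef0 G0 horner_coef0.
  split; rewrite ?mem0v ?memvf //; first exact: okpoly_comp.
    by rewrite horner_comp -f0; apply: horner_close.
  rewrite subr0 c0 muln1; split=> //.
  rewrite coef_comp_X0 // big_ord_recl big_ord1 /= expr0 expr1 coef1 mulr0 add0r.
  by rewrite lowG // mulr0; apply: vge0.
have exp2 : expands w fullv (n * m) 1 B' H pi' piK.
  apply: (expands_uniformizer hw (E := fullv)) => //; first exact: memvf.
  by rewrite muln1.
have eC := lev_expands hw (E := fullv) dimM nm_gt1 (ltn0Sn 0) hK1 (p ^ j) NB1 thB' exp1 exp2.
have close t : vge w ((tay piM (f \Po G))`_t - (A \Po y)`_t) th.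
  rewrite tay_comp // -coefB -comp_polyB comp_polyE coef_sum.
  apply: vge_sum => // k _; rewrite coefZ; apply: vgeMr => //; last exact: ipolyX.
  by rewrite coefB; apply: vge_le thB' _; apply: tay_close.
have eL : lev w (fun t => (A \Po y)`_t) (p ^ j) th <->
    lev w (fun t => (tay piM (f \Po G))`_t) (p ^ j) th.
  split=> h t ht.
    rewrite -[_`_t](subrK (A \Po y)`_t); apply: vgeD => //; exact: h.
  rewrite -[_`_t](subKr (tay piM (f \Po G))`_t); apply: vgeB => //; exact: h.
rewrite eL eC eH; split=> h k; last first.
  by case: (iMK j) h => // k' h [<-]; rewrite mul1n; apply: h.
by move=> Ek; have := h (1 * (n * m + k))%N; rewrite Ek /= mul1n => /(_ erefl).
Qed.

(** With th one above nm + a, some coefficient of index at most p^j stays below th; the lower bound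
    for it supplies the pair. *)
Lemma tower_lower j a : (j <= logn p (n * m))%N -> iMK j = Some a ->
  exists c k b d, [/\ (c <= nu)%N, (k <= mu)%N, (c + k <= j)%N,
    iLK c = Some b /\ iML k = Some d & (m * b + p ^ c * d <= a)%N].
Proof.
move=> jle Ea; pose th := (n * m + a)%:Z + 1.
have [A [y [y0 yint hA hy hcmp]]] := tower_comparison th.
have [t [/andP[t0 tj] nt]] : exists t, (0 < t <= p ^ j)%N /\ ~ vge w (A \Po y)`_t th.
  apply: contrapT => nex.
  have : lev w (fun t => (A \Po y)`_t) (p ^ j) th.
    by move=> t ht; apply: contrapT => nt; apply: nex; exists t.
  by move/(hcmp _ _ jle (lexx _))/(_ a Ea); rewrite /th; clear; lia.
have [C0|[c [k [b [d [c_nu k_mu ckt [Ib Jd] le]]]]]] :=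
  composition_lower hw p_pr y0 yint base_index_chain hA hy t0.
  by case: nt; rewrite C0; apply: vge0.
move: Ib; rewrite /ILK; case Eb : (iLK c) => [b'|] //= [eb].
exists c, k, b', d; split=> //.
  by rewrite -(leq_exp2l _ _ (prime_gt1 p_pr)) (leq_trans ckt).
have /vgeNP[_ lt] := nt; move: (le_lt_trans le lt); rewrite /th -eb mulnDr mulnC.
by clear; lia.
Qed.

Lemma tower_upper j0 k0 a0 b0 : (j0 <= nu)%N -> (k0 <= mu)%N ->
  iLK j0 = Some a0 -> iML k0 = Some b0 ->
  (forall c k a b, (c <= nu)%N -> (k <= mu)%N -> (c + k <= j0 + k0)%N ->
     iLK c = Some a -> iML k = Some b ->
     (m * a + p ^ c * b <= m * a0 + p ^ j0 * b0)%N -> c = j0 /\ k = k0) ->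
  exists2 r, iMK (j0 + k0)%N = Some r & (r <= m * a0 + p ^ j0 * b0)%N.
Proof.
move=> j0nu k0mu Ea Eb huniq; set V := (m * a0 + p ^ j0 * b0)%N.
pose th := (n * m + V)%:Z + 1.
have [A [y [y0 yint hA hy hcmp]]] := tower_comparison th.
have Ia : ILK j0 = Some (m * (n + a0))%N by rewrite /ILK Ea.
have [|C0 wC] := composition_exact hw p_pr y0 yint base_index_chain hA hy j0nu k0mu Ia Eb.
  move=> c k a b c_nu k_mu ck; rewrite /ILK; case Ec : (iLK c) => [a'|] //= [<-] Ek.
  rewrite !mulnDr -!addnA leq_add2l; exact: huniq.
have jle : (j0 + k0 <= logn p (n * m))%N.
  by rewrite lognM // leq_add.
have nl : ~ lev w (fun t => (A \Po y)`_t) (p ^ (j0 + k0)) th.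
  move/(_ (p ^ (j0 + k0))%N); rewrite leqnn expn_gt0 prime_gt0 // => /(_ isT).
  move/(vge_neq0 C0); rewrite wC /th /V mulnDr [(n * m)%N]mulnC; clear; lia.
apply: contrapT => nex; apply: nl; apply/(hcmp _ _ jle (lexx _)) => r Er.
have [rV|Vr] := leqP r V; first by case: nex; exists r.
by rewrite /th; move: Vr; clear; lia.
Qed.

Lemma tower_index_facts :
  [/\ iML mu = Some 0%N,
      forall k, (k <= mu)%N -> iML k = Some 0%N -> k = mu,
      forall j j' a, (j <= j' <= nu)%N -> iLK j = Some a ->
        exists2 a', iLK j' = Some a' & (a' <= a)%N &
      forall k k' b, (k <= k' <= mu)%N -> iML k = Some b ->
        exists2 b', iML k' = Some b' & (b' <= b)%N].
Proof. by have [_ _ ? _ _] := LK_spec; have [? ? ? _ _] := ML_spec. Qed.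

End Tower.

(* For x = 0 the minimum may be attained at several levels c + k; the lowest
   one still carries a unique pair. *)
Lemma lowest_minimizer_unique (p m nu mu l0 V : nat) (I J : nat -> option nat) :
  (0 < p)%N -> (0 < m)%N -> J mu = Some 0%N ->
  (forall k, (k <= mu)%N -> J k = Some 0%N -> k = mu) ->
  (forall j j' a, (j <= j' <= nu)%N -> I j = Some a ->
     exists2 a', I j' = Some a' & (a' <= a)%N) ->
  (forall k k' b, (k <= k' <= mu)%N -> J k = Some b ->
     exists2 b', J k' = Some b' & (b' <= b)%N) ->
  let attains c k := [/\ (c <= nu)%N, (k <= mu)%N &
    exists a b, [/\ I c = Some a, J k = Some b & (m * a + p ^ c * b)%N = V]] in
  (forall c k a b, (c <= nu)%N -> (k <= mu)%N -> (c + k <= l0)%N ->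
     I c = Some a -> J k = Some b -> (V <= m * a + p ^ c * b)%N) ->
  forall j0 k0, (j0 + k0 = l0)%N -> attains j0 k0 ->
  (forall c k, (c + k = l0)%N -> attains c k -> c = j0 /\ k = k0) ->
  exists j1 k1, [/\ (j1 + k1 <= l0)%N, attains j1 k1 &
    forall c k, (c + k <= j1 + k1)%N -> attains c k -> c = j1 /\ k = k1].
Proof.
move=> p0 m0 Jmu J0 monoI monoJ attains hmin j0 k0 e0 at0 uniq0.
pose P l := `[< exists c k, (c + k = l)%N /\ attains c k >].
have exP : exists l, P l by exists l0; apply/asboolP; exists j0, k0.
case: (ex_minnP exP) => l1 /asboolP[j1 [k1 [e1 at1]]] l1min.
have l1l0 : (l1 <= l0)%N by apply: l1min; apply/asboolP; exists j0, k0.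
(* Raising k, or raising c once k has reached mu, increases no index; so a minimizing pair moved up
   to level l0 still minimizes and must be (j0, k0). *)
have up c k c' k' : attains c k -> (c' <= nu)%N -> (k <= k' <= mu)%N ->
    (c' + k' = l0)%N -> c' = c \/ (c <= c')%N /\ k' = mu -> c' = j0 /\ k' = k0.
  move=> [cnu kmu [a [b [Ia Jb eV]]]] c'nu kk' e' hc.
  have [b' Jb' b'b] := monoJ k k' b kk' Jb.
  apply: uniq0 => //; case: (hc) => [ec|[cc' ek']].
    split=> //; first by case/andP: kk'.
    exists a, b'; rewrite ec; split=> //; apply/eqP; rewrite eqn_leq; apply/andP; split.
      by rewrite -eV leq_add2l leq_mul2l b'b orbT.
    by apply: (hmin c k') => //; [case/andP: kk'|rewrite -ec e'].
  have [a' Ia' a'a] := monoI c c' a (introT andP (conj cc' c'nu)) Ia.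
  split=> //; first by rewrite ek'.
  exists a', 0%N; rewrite ek'; split=> //; apply/eqP; rewrite eqn_leq; apply/andP; split.
    by rewrite muln0 addn0 -eV (leq_trans _ (leq_addr _ _)) // leq_mul2l a'a orbT.
  by apply: (hmin c' mu) => //; rewrite -ek' e'.
have j0nu : (j0 <= nu)%N by case: at0.
have k0mu : (k0 <= mu)%N by case: at0.
(* If both second components can be raised by l0 - l1, the first components stay different, against
   uniqueness at level l0. *)
have nlt c k c' k' : (c + k = l1)%N -> (c' + k' = l1)%N -> attains c k ->
    attains c' k' -> ~ (c < c')%N.
  move=> e e' ack ack' cc'; have [cnu kmu _] := ack; have [c'nu k'mu hV'] := ack'.
  have [kd|kd] := leqP (k + (l0 - l1)) mu.
    have [c_j0 _] : c = j0 /\ (k + (l0 - l1))%N = k0.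
      by apply: (up c k) => //; [rewrite leq_addr|move: e l1l0; clear; lia|left].
    have [c'_j0 _] : c' = j0 /\ (k' + (l0 - l1))%N = k0.
      apply: (up c' k') => //; last by left.
        by rewrite leq_addr; move: kd e e' cc'; clear; lia.
      by move: e' l1l0; clear; lia.
    by move: cc'; rewrite c_j0 c'_j0 ltnn.
  (* Here k reaches mu before level l0, which forces k0 = mu and b0 = 0. *)
  have [ej0 ek0] : (l0 - mu)%N = j0 /\ mu = k0.
    apply: (up c k) => //.
    - by move: e0 j0nu k0mu; clear; lia.
    - by rewrite kmu leqnn.
    - by move: e l1l0 kd k0mu e0 kmu; clear; lia.
    - by right; split=> //; move: e l1l0 kd; clear; lia.
  have c'j0 : (c' <= j0)%N.
    have [k'd|k'd] := leqP (k' + (l0 - l1)) mu; last first.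
      by rewrite -ej0; move: e' l1l0 k'd; clear; lia.
    have [-> //] : c' = j0 /\ (k' + (l0 - l1))%N = k0.
    apply: (up c' k') => //; [by rewrite leq_addr k'd| |by left].
    by move: e' l1l0; clear; lia.
  case: hV' => a' [b' [Ia' Jb' eV']].
  case: at0 => _ _ [a0 [b0 [Ia0 Jb0 eV0]]].
  have [a1 Ia1 a1a'] := monoI c' j0 a' (introT andP (conj c'j0 j0nu)) Ia'.
  have b00 : b0 = 0%N by move: Jb0; rewrite -ek0 Jmu => -[].
  have a01 : a0 = a1 by move: Ia1; rewrite Ia0 => -[].
  (* V = m a0 <= m a' because I is nonincreasing, so nothing is left for p^c' b'; then k' = mu >= k,
     a contradiction. *)
  have b'0 : b' = 0%N.
    have : (m * a0 + 0 <= m * a')%N by rewrite addn0 leq_mul2l a01 a1a' orbT.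
    move: eV0; rewrite b00 muln0 => ->; rewrite -eV' -[X in (_ <= X)%N]addn0 leq_add2l leqn0.
    by rewrite muln_eq0 expn_eq0 (gtn_eqF p0) /= => /eqP.
  have ek' : k' = mu by apply: J0 => //; rewrite Jb' b'0.
  by move: cc' e e' kmu; rewrite ek'; clear; lia.
exists j1, k1; rewrite e1; split=> // c k ck ack.
have ce : (c + k = l1)%N.
  by apply/eqP; rewrite eqn_leq ck /=; apply: l1min; apply/asboolP; exists c, k.
have n1 := nlt _ _ _ _ ce e1 ack at1; have n2 := nlt _ _ _ _ e1 ce at1 ack.
by move: n1 n2 ce e1; clear; lia.
Qed.

(** * The piecewise linear functions over the extended reals *)

Section ExtendedReals.
Variables (R : realType) (p m : nat) (iLK iML : nat -> option nat).
Hypothesis p_gt0 : (0 < p)%N.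
Hypothesis m_gt0 : (0 < m)%N.
Implicit Types (x : R) (y z : \bar R).
Local Open Scope ereal_scope.

Lemma tphiE (i : nat -> option nat) j x : tphi p i j x%:E =
  if i j is Some a then (a%:R + (p ^ j)%:R * x)%:E else +oo.
Proof. by rewrite /tphi; case: (i j). Qed.

Lemma tphim_tphiE c k x : tphim p iLK m c (tphi p iML k x%:E) =
  match iLK c, iML k with
  | Some a, Some b => ((m * a + p ^ c * b)%:R + (p ^ (c + k))%:R * x)%:E
  | _, _ => +oo
  end.
Proof.
have mR : (m%:R : R) != 0%R by rewrite pnatr_eq0 -lt0n.
have m0 : (0 < (m%:R : R))%R by rewrite ltr0n.
have p0 : (0 < ((p ^ c)%:R : R))%R by rewrite ltr0n expn_gt0 p_gt0.
rewrite /tphim tphiE; case: (iML k) => [b|]; last first.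
  rewrite gt0_mulye ?lte_fin ?invr_gt0 // /tphi gt0_muley ?lte_fin //.
  by rewrite addey ?gt0_muley ?lte_fin //; case: (iLK c) => [a|].
rewrite /tphi; case: (iLK c) => [a|] /=; last by rewrite gt0_muley ?lte_fin.
congr EFin; rewrite expnD !natrD !natrM.
by field.
Qed.

Lemma tphim_mono c y z : y <= z -> tphim p iLK m c y <= tphim p iLK m c z.
Proof.
move=> yz; apply: lee_wpmul2l; first by rewrite lee_fin ler0n.
apply: leeD2l; apply: lee_wpmul2l; first by rewrite lee_fin ler0n.
by apply: lee_wpmul2r => //; rewrite lee_fin invr_ge0 ler0n.
Qed.

Lemma phi_le (i : nat -> option nat) j j0 y : (j0 <= j)%N ->
  phi p i j y <= tphi p i j0 y.
Proof.
by rewrite -ltnS => h; apply: (bigmin_le +oo (Ordinal h) (fun k : 'I_j.+1 => tphi p i k y)).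
Qed.

(** Every pair of level at most l lies componentwise below one of level exactly l, and the inner
    minima of [phi] reach down to it. *)
Lemma lambdaMK_le nu mu l c k x : (l <= nu + mu)%N ->
  (c <= nu)%N -> (k <= mu)%N -> (c + k <= l)%N ->
  lambdaMK p iLK iML m nu mu l x <= tphim p iLK m c (tphi p iML k x%:E).
Proof.
move=> lnm cnu kmu ckl.
have [j [k' [jnu k'mu jk' cj kk']]] : exists j k', [/\ (j <= nu)%N, (k' <= mu)%N,
    (j + k' = l)%N, (c <= j)%N & (k <= k')%N].
  by exists (l - minn mu (l - c))%N, (minn mu (l - c)); split; move: lnm cnu kmu ckl; clear; lia.
rewrite -ltnS in jnu; rewrite -ltnS in k'mu.
apply: (@le_trans _ _ (phim p iLK m j (phi p iML k' x%:E))).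
  apply: (bigmin_inf (Ordinal jnu)) => //.
  by apply: (bigmin_inf (Ordinal k'mu)) => //=; rewrite jk'.
apply: (@le_trans _ _ (tphim p iLK m c (phi p iML k' x%:E))).
  apply: lee_wpmul2l; first by rewrite lee_fin ler0n.
  exact: phi_le.
by apply: tphim_mono; apply: phi_le.
Qed.

End ExtendedReals.

Theorem theorem3p3 (R : realType) (p : nat) (K : fieldType)
  (M : fieldExtType K) (L : {subfield M}) (w : M -> int) (n m : nat)
  (iLK iML iMK : nat -> option nat) (l : nat) (x : R) :
  prime p ->
  is_norm_dvaluation w ->
  (* K is discretely valued (v_K = w/(nm)), complete, residue field perfect of char p *)
  complete_in w 1%VS ->
  residue_perfect_char w 1%VS p ->
  (* M/K (hence L/K, M/L) is separable, i.e. M lies in K^sep *)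
  separable (1%VS : {vspace M}) fullv ->
  (* degrees *)
  (1 < n)%N -> (1 < m)%N ->
  \dim L = n -> \dim {:M} = (n * m)%N ->
  (* total ramification: w(K^x) = nm Z, w(L^x) = m Z, w(M^x) = Z *)
  (forall y, y \in 1%VS -> y != 0 -> ((n * m)%:Z %| w y)%Z) ->
  (exists y, y \in 1%VS /\ w y = (n * m)%N) ->
  (forall y, y \in (L : {vspace M}) -> y != 0 -> (m%:Z %| w y)%Z) ->
  (exists y, y \in (L : {vspace M}) /\ w y = m) ->
  (* the indices of inseparability *)
  is_indices w p 1%VS L m n iLK ->
  is_indices w p L fullv 1 m iML ->
  is_indices w p 1%VS fullv 1 (n * m) iMK ->
  (l <= logn p n + logn p m)%N ->
  0 <= x ->
  (lambdaMK p iLK iML m (logn p n) (logn p m) l x <= phi p iMK l x%:E)%E /\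
  ((exists l0, (l0 <= l)%N /\
      #|S_set p iLK iML m (logn p n) (logn p m) l l0 x| = 1%N) ->
   phi p iMK l x%:E = lambdaMK p iLK iML m (logn p n) (logn p m) l x).
Proof.
move=> p_pr hw hcomp [hp _] _ n1 m1 dimL dimM hK _ _ _ hLK hML hMK lnm x0.
have p_gt1 := prime_gt1 p_pr; have p_gt0 := prime_gt0 p_pr.
have m_gt0 := ltnW m1; have n_gt0 := ltnW n1.
set nu := logn p n in lnm *; set mu := logn p m in lnm *.
set lam := lambdaMK _ _ _ _ _ _ _ _.
have lnmE : logn p (n * m) = (nu + mu)%N by rewrite lognM.
have lam_le c k a b : (c <= nu)%N -> (k <= mu)%N -> (c + k <= l)%N ->
    iLK c = Some a -> iML k = Some b ->
    (lam <= ((m * a + p ^ c * b)%:R + (p ^ (c + k))%:R * x)%:E)%E.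
  move=> cnu kmu ckl Ea Eb.
  have := lambdaMK_le p m iLK iML x lnm cnu kmu ckl.
  by rewrite tphim_tphiE // Ea Eb.
have pX c j : (c <= j)%N -> (p ^ c)%:R * x <= (p ^ j)%:R * x.
  by move=> cj; rewrite ler_wpM2r // ler_nat leq_exp2l.
have lower : (lam <= phi p iMK l x%:E)%E.
  apply: le_bigmin; first exact: leey.
  move=> [j jl] _ /=; rewrite tphiE; case Ej : (iMK j) => [a|]; last exact: leey.
  have jle : (j <= logn p (n * m))%N by rewrite lnmE; apply: leq_trans lnm.
  have [c [k [b [d [cnu kmu ckj [Eb Ed] le]]]]] :=
    tower_lower p_pr hw hcomp hp n1 m1 dimL dimM hK hLK hML hMK jle Ej.
  apply: (le_trans (lam_le c k b d cnu kmu (leq_trans ckj jl) Eb Ed)).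
  by rewrite lee_fin lerD ?ler_nat // pX.
split=> // -[l0 [l0l /eqP/cards1P[[j0 k0] S1]]].
apply/eqP; rewrite eq_le lower andbT.
have inS (c k : nat) (cnu : (c < nu.+1)%N) (kmu : (k < mu.+1)%N) : (c + k = l0)%N ->
    tphim p iLK m c (tphi p iML k x%:E) = lam -> c = j0 /\ k = k0.
  move=> ck e; have : (Ordinal cnu, Ordinal kmu) \in S_set p iLK iML m nu mu l l0 x.
    by rewrite inE /= ck eqxx /= e.
  by rewrite S1 inE => /eqP[<- <-].
have : (j0, k0) \in S_set p iLK iML m nu mu l l0 x by rewrite S1 inE.
rewrite inE /= => /andP[/eqP e0 /eqP]; rewrite -/lam tphim_tphiE //.
have j0nu : (j0 <= nu)%N by rewrite -ltnS.
have k0mu : (k0 <= mu)%N by rewrite -ltnS.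
case Ea0 : (iLK j0) => [a0|]; last by move=> <-; apply: leey.
case Eb0 : (iML k0) => [b0|]; last by move=> <-; apply: leey.
set V := (m * a0 + p ^ j0 * b0)%N => elam.
(* Such a pair has value at most lambda, and lambda is a lower bound. *)
have lev_eq c k a b : (c <= nu)%N -> (k <= mu)%N -> (c + k <= l0)%N ->
    iLK c = Some a -> iML k = Some b -> (m * a + p ^ c * b <= V)%N ->
    (c + k = l0)%N \/ x = 0 -> (m * a + p ^ c * b)%:R + (p ^ (c + k))%:R * x = V%:R + (p ^ l0)%:R * x.
  move=> cnu kmu ck Ea Eb le h; apply: le_anti; apply/andP; split.
    by apply: lerD; [rewrite ler_nat|apply: pX].
  have := lam_le c k a b cnu kmu (leq_trans ck l0l) Ea Eb.
  by rewrite -elam e0 lee_fin.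
(* [tower_upper] needs uniqueness among all pairs of level at most its own, hence a possibly lower
   pair of the same value. *)
have [j1 [k1 [a1 [b1 [lvl1 [j1nu k1mu] [Ea1 Eb1] val1 uniq1]]]]] :
    exists j1 k1 a1 b1, [/\ (j1 + k1 <= l0)%N, (j1 <= nu)%N /\ (k1 <= mu)%N,
      iLK j1 = Some a1 /\ iML k1 = Some b1,
      (m * a1 + p ^ j1 * b1)%:R + (p ^ (j1 + k1))%:R * x = V%:R + (p ^ l0)%:R * x &
      forall c k a b, (c <= nu)%N -> (k <= mu)%N -> (c + k <= j1 + k1)%N ->
        iLK c = Some a -> iML k = Some b ->
        (m * a + p ^ c * b <= m * a1 + p ^ j1 * b1)%N -> c = j1 /\ k = k1].
  have uniq0 c k a b : (c <= nu)%N -> (k <= mu)%N -> (c + k = l0)%N ->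
      iLK c = Some a -> iML k = Some b -> (m * a + p ^ c * b <= V)%N ->
      c = j0 /\ k = k0.
    move=> cnu kmu ck Ea Eb le; apply: inS => //.
    rewrite tphim_tphiE // Ea Eb -elam e0; congr EFin.
    by apply: lev_eq => //; [rewrite ck|left].
  have [xE|xn0] := eqVneq x 0; last first.
    exists j0, k0, a0, b0; rewrite e0; split=> // c k a b cnu kmu ck Ea Eb le.
    move: (ck); rewrite leq_eqVlt => /orP[/eqP ck'|lt]; first exact: (uniq0 c k a b).
    (* At a strictly lower level p^(c + k) x < p^l0 x, so the value would fall below lambda. *)
    have xgt0 : 0 < x by rewrite lt_neqAle eq_sym xn0.
    have := lam_le c k a b cnu kmu (leq_trans ck l0l) Ea Eb.
    rewrite -elam e0 lee_fin leNgt => /negP[]; apply: ler_ltD; first by rewrite ler_nat.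
    by rewrite ltr_pM2r // ltr_nat ltn_exp2l.
  have [Jmu J0 monoI monoJ] := tower_index_facts p_pr hw hcomp hp n1 m1 dimM hK hLK hML.
  have hmin c k a b : (c <= nu)%N -> (k <= mu)%N -> (c + k <= l0)%N ->
      iLK c = Some a -> iML k = Some b -> (V <= m * a + p ^ c * b)%N.
    move=> cnu kmu ck Ea Eb.
    have := lam_le c k a b cnu kmu (leq_trans ck l0l) Ea Eb.
    by rewrite -elam lee_fin xE !mulr0 !addr0 ler_nat.
  have [||j1 [k1 [lvl1 [j1nu k1mu [a1 [b1 [Ea1 Eb1 v1]]]] uniq1]]] :=
    lowest_minimizer_unique p_gt0 m_gt0 Jmu J0 monoI monoJ hmin e0.
  - by split=> //; exists a0, b0.
  - move=> c k ck [cnu kmu [a [b [Ea Eb v]]]].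
    by apply: (uniq0 c k a b) => //; rewrite v.
  exists j1, k1, a1, b1; split=> //; first by rewrite v1 xE !mulr0.
  move=> c k a b cnu kmu ck Ea Eb; rewrite v1 => le.
  apply: uniq1 => //; split=> //; exists a, b; split=> //.
  by apply/eqP; rewrite eqn_leq le (hmin c k a b cnu kmu (leq_trans ck lvl1)).
have [r Er rle] := tower_upper p_pr hw hcomp hp n1 m1 dimL dimM hK hLK hML hMK
  j1nu k1mu Ea1 Eb1 uniq1.
apply: (le_trans (phi_le p iMK x%:E (leq_trans lvl1 l0l))).
by rewrite tphiE Er -elam lee_fin e0 -val1 lerD2r ler_nat.
Qed.
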